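(* Let $\mathbf A=(A;A_1,A_2;M)$ be a double affine bundle. Then there exist an open covering $\{U_\alpha\}_{\alpha\in\mathcal I}$ of $M$, affine spaces $K_1,K_2,K$ and diffeomorphisms $$\varphi_\alpha: A_{|U_\alpha}\to U_\alpha\times K_1\times K_2\times K$$ inducing isomorphisms of $A_{|U_\alpha}$ with the trivial double affine bundle $(U_\alpha\times K_1\times K_2\times K;\ U_\alpha\times K_1,\ U_\alpha\times K_2;\ U_\alpha)$, such that, with respect to local coordinates $x$ on $M$ and affine coordinates $(y^j)$, $(z^a)$, $(c^u)$ on $K_1$, $K_2$, $K$, the gluing $\varphi_\beta\circ\varphi_\alpha^{-1}:(x,y,z,c)\mapsto(x',y',z',c')$ over $U_\alpha\cap U_\beta$ has the form $$x'=x'(x),\qquad {y^j}'=\alpha_0^j(x)+\sum_i\alpha_i^j(x)y^i,\qquad {z^a}'=\beta_0^a(x)+\sum_b\beta_b^a(x)z^b,$$ $${c^u}'=\gamma_{00}^u(x)+\sum_i\gamma_{i0}^u(x)y^i+\sum_b\gamma_{0b}^u(x)z^b+\sum_{i,b}\gamma_{ib}^u(x)y^iz^b+\sum_w\sigma_w^u(x)c^w,$$ with coefficients that are smooth functions of $x$.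
   Context: All manifolds and maps are smooth, bundles have finite rank, and the base $M$ is connected. In an affine space write $\mathrm{aff}(a,b;\lambda)=b+\lambda[b,a]$ (that is, $\lambda a+(1-\lambda)b$), where $[b,a]$ is the vector from $b$ to $a$. A double affine bundle $\mathbf A=(A;A_1,A_2;M)$ is a commuting diagram of four affine bundles $\pi_1:A\to A_1$, $\pi_2:A\to A_2$, $\pi_1':A_2\to M$, $\pi_2':A_1\to M$ (so $\pi_2'\circ\pi_1=\pi_1'\circ\pi_2$) such that: (i) $(\pi_1,\pi_1')$ is a morphism of affine bundles from $\pi_2:A\to A_2$ to $\pi_2':A_1\to M$, and $(\pi_2,\pi_2')$ is a morphism of affine bundles from $\pi_1:A\to A_1$ to $\pi_1':A_2\to M$; (ii) $(\pi_1,\pi_2):A\to A_1\times_M A_2$ is surjective; (iii) denoting by $\mathrm{aff}_i(x,y;\lambda)$ the affine combination, with weights $\lambda$ and $1-\lambda$, of two points $x,y$ in the same fibre of $\pi_i$, for each $\lambda\in\mathbb R$ and $i=1,2$ the map $\mathrm{aff}_i(-,-;\lambda):A\times_{\pi_i}A\to A$ is a morphism of affine bundles (for $i=1$: from $A\times_{\pi_1}A\to A_2\times_{\pi_1'}A_2$ to $\pi_2:A\to A_2$; for $i=2$ symmetrically). The trivial double affine bundle over $U$ with affine spaces $K_1,K_2,K$ has total space $U\times K_1\times K_2\times K$ with the obvious projections onto $U\times K_1$, $U\times K_2$ and then $U$. For $U\subset M$, $A_{|U}=(\pi_1'\circ\pi_2)^{-1}(U)$. *)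

(* Defs.v *)
From HB Require Import structures.
From mathcomp Require Import all_boot all_order all_algebra.
From mathcomp Require Import all_classical all_reals all_analysis.

Set Implicit Arguments.
Unset Strict Implicit.
Unset Printing Implicit Defensive.

Import Order.TTheory GRing.Theory Num.Theory.
Import numFieldNormedType.Exports.
Local Open Scope classical_set_scope.
Local Open Scope ring_scope.

Section SmoothManifolds.
Variable R : realType.

(** [U] is meant to be open; continuity of all iterated directional derivatives
    is the usual C^k condition. *)
Fixpoint class_C (m n k : nat) (U : set 'rV[R]_m) (f : 'rV[R]_m -> 'rV[R]_n)
    : Prop :=
  (forall x, U x -> {for x, continuous f}) /\
  if k is k'.+1 then
    forall v : 'rV[R]_m,
      (forall x, U x -> derivable f x v) /\ class_C k' U (fun x => 'D_v f x)
  else True.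

Definition Cinfty (m n : nat) (U : set 'rV[R]_m) (f : 'rV[R]_m -> 'rV[R]_n) :=
  forall k, class_C k U f.

(** [cmap] and [cinv] only matter on [cdom] and on [cmap @` cdom]. *)
Record chart (X : topologicalType) (n : nat) := Chart {
  cdom : set X;
  cmap : X -> 'rV[R]_n;
  cinv : 'rV[R]_n -> X }.

Record charted_space := ChartedSpace {
  cspace :> topologicalType;
  cdim : nat;
  atlas : set (chart cspace cdim) }.

Definition is_chart (X : topologicalType) (n : nat) (u : chart X n) :=
  [/\ open (cdom u),
      open (cmap u @` cdom u),
      (forall x, cdom u x -> cinv u (cmap u x) = x),
      (forall x, cdom u x -> {for x, continuous (cmap u)}) &
      (forall w, (cmap u @` cdom u) w -> {for w, continuous (cinv u)})].

Definition smooth_manifold (X : charted_space) :=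
  [/\ hausdorff_space X,
      @second_countable X,
      (forall x : X, exists2 u, atlas u & cdom u x),
      (forall u, @atlas X u -> is_chart u) &
      (forall u v, @atlas X u -> atlas v ->
         Cinfty (cmap u @` (cdom u `&` cdom v)) (cmap v \o cinv u))].

(** Smoothness of [f] on an open set [W]. *)
Definition smooth_on_open (X Y : charted_space) (W : set X) (f : X -> Y) :=
  (forall x, W x -> {for x, continuous f}) /\
  (forall u v, @atlas X u -> @atlas Y v ->
     Cinfty (cmap u @` (W `&` cdom u `&` f @^-1` cdom v))
            (cmap v \o f \o cinv u)).

(** Smoothness on an arbitrary subset [S]: [f] extends locally to a smooth map.
    On open subsets this is ordinary smoothness, and on an embedded submanifold
    (such as a fibre product of bundles) it is smoothness for the submanifold
    structure. *)
Definition smooth_on (X Y : charted_space) (S : set X) (f : X -> Y) :=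
  forall x, S x -> exists (W : set X) (F : X -> Y),
    [/\ open W, W x, (forall y, S y -> W y -> F y = f y) & smooth_on_open W F].

Definition euclidean (n : nat) : charted_space :=
  @ChartedSpace 'rV[R]_n n [set Chart setT id id].

Definition real_line : charted_space :=
  @ChartedSpace R 1 [set Chart setT (fun r : R => const_mx r : 'rV[R]_1)
                                    (fun v : 'rV[R]_1 => v 0 0)].

Definition chart_prod (X Y : topologicalType) (m n : nat)
    (u : chart X m) (v : chart Y n) : chart (X * Y)%type (m + n) :=
  Chart (cdom u `*` cdom v)
        (fun p => row_mx (cmap u p.1) (cmap v p.2))
        (fun w => (cinv u (lsubmx w), cinv v (rsubmx w))).

Definition product (X Y : charted_space) : charted_space :=
  @ChartedSpace (X * Y)%type (cdim X + cdim Y)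
    [set w | exists u v, [/\ @atlas X u, @atlas Y v & w = chart_prod u v]].

(** A subset of a charted space, standing for an open submanifold or an embedded
    submanifold. *)
Record space := Space { ambient :> charted_space; carrier : set ambient }.
Arguments carrier : clear implicits.

Definition whole (X : charted_space) : space := @Space X setT.

Definition restr (E : space) (S : set E) : space := @Space E (carrier E `&` S).

Definition prod_space (E F : space) : space :=
  @Space (product E F) (carrier E `*` carrier F).

Definition manifold (E : space) := smooth_manifold E /\ open (carrier E).

Definition smooth_map (E F : space) (f : E -> F) :=
  smooth_on (carrier E) f /\ (forall x, carrier E x -> carrier F (f x)).

Definition diffeo_with_inverse (E F : space) (f : E -> F) (g : F -> E) :=
  [/\ smooth_map f, smooth_map g,
      (forall x, carrier E x -> g (f x) = x) &
      (forall y, carrier F y -> f (g y) = y)].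

Definition diffeo (E F : space) (f : E -> F) :=
  exists g, diffeo_with_inverse f g.

End SmoothManifolds.

Arguments carrier {R} s _.

Section AffineBundles.
Variable R : realType.

(** The structure of an affine space is carried by the operation
    [aff a b l] = b + l [b,a], i.e. [l a + (1 - l) b], which determines it:
    [vec a b] is the vector [a,b] from [a] to [b], and [add a v] is [a + v].
    Values of [aff], [vec] and [add] off [S] are irrelevant. *)
Definition affine_space (E : Type) (S : set E) (aff : E -> E -> R -> E) :=
  S !=set0 /\
  exists (V : vectType R) (vec : E -> E -> V) (add : E -> V -> E),
    [/\ (forall a v, S a -> S (add a v) /\ vec a (add a v) = v),
        (forall a b, S a -> S b -> add a (vec a b) = b),
        (forall a b c, S a -> S b -> S c -> vec a b + vec b c = vec a c) &
        (forall a b l, S a -> S b -> aff a b l = add b (l *: vec b a))].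

(** [aff a b l] is only meaningful for [a] and [b] in the same fibre. *)
Record bundle (E B : space R) := Bundle {
  proj :> E -> B;
  aff : E -> E -> R -> E }.

Definition fibre (E B : space R) (p : bundle E B) (b : B) : set E :=
  [set a | carrier E a /\ p a = b].

Definition affine_morphism (E B E' B' : space R)
    (p : bundle E B) (p' : bundle E' B') (F : E -> E') (f : B -> B') :=
  [/\ smooth_map F, smooth_map f,
      (forall a, carrier E a -> p' (F a) = f (p a)) &
      (forall a b l, carrier E a -> carrier E b -> p a = p b ->
         F (aff p a b l) = aff p' (F a) (F b) l)].

Definition affR (n : nat) (a b : 'rV[R]_n) (l : R) : 'rV[R]_n :=
  l *: a + (1 - l) *: b.

Definition trivial_bundle (B : space R) (n : nat) :
    bundle (prod_space B (whole (euclidean R n))) B :=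
  @Bundle (prod_space B (whole (euclidean R n))) B
    (fun a => a.1) (fun a b l => (b.1, affR a.2 b.2 l)).

Definition restr_bundle (E B : space R) (p : bundle E B) (S : set B) :
    bundle (restr (p @^-1` S)) (restr S) :=
  @Bundle (restr (p @^-1` S)) (restr S) (proj p) (aff p).

Definition affine_bundle (E B : space R) (p : bundle E B) :=
  [/\ manifold E, manifold B, smooth_map p,
      (forall b, carrier B b -> affine_space (fibre p b) (aff p)) &
      exists n, forall b, carrier B b -> exists U : set B,
        [/\ open U, U b &
          exists Phi : E -> product B (euclidean R n),
            diffeo (E := restr (p @^-1` U))
                   (F := prod_space (restr U) (whole (euclidean R n))) Phi /\
            affine_morphism (restr_bundle p U)
                            (trivial_bundle (restr U) n) Phi id]].

(** The fibre product of [E] with itself over [B]. *)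
Definition fibre_square (E B : space R) (p : bundle E B) : space R :=
  @Space R (product E E) [set a | carrier (prod_space E E) a /\ p a.1 = p a.2].

(** For bundles [p : E -> E1], [q : E -> E2], [p' : E2 -> M] as in a double
    affine bundle, the bundle [q x q] from E x_p E to E2 x_p' E2, whose fibre
    over (b, b') is an affine subspace of the product of the fibres of [q] over
    b and b'. *)
Definition square_bundle (E E1 E2 M : space R)
    (p : bundle E E1) (q : bundle E E2) (p' : bundle E2 M) :
    bundle (fibre_square p) (fibre_square p') :=
  @Bundle (fibre_square p) (fibre_square p')
    (fun a => (q a.1, q a.2))
    (fun a b l => (aff q a.1 b.1 l, aff q a.2 b.2 l)).

Record dbundle := DBundle {
  tot : space R;
  side1 : space R;
  side2 : space R;
  base : space R;
  pi1 : bundle tot side1;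
  pi2 : bundle tot side2;
  pi1' : bundle side2 base;
  pi2' : bundle side1 base }.

Definition double_affine_bundle (D : dbundle) :=
  [/\ [/\ affine_bundle (pi1 D), affine_bundle (pi2 D),
          affine_bundle (pi1' D), affine_bundle (pi2' D) &
          forall a, carrier (tot D) a -> pi2' D (pi1 D a) = pi1' D (pi2 D a)],
      affine_morphism (pi2 D) (pi2' D) (pi1 D) (pi1' D) /\
      affine_morphism (pi1 D) (pi1' D) (pi2 D) (pi2' D),
      (forall a1 a2, carrier (side1 D) a1 -> carrier (side2 D) a2 ->
         pi2' D a1 = pi1' D a2 ->
         exists a, [/\ carrier (tot D) a, pi1 D a = a1 & pi2 D a = a2]) &
      forall l : R,
        (exists f, affine_morphism (square_bundle (pi1 D) (pi2 D) (pi1' D))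
                     (pi2 D) (fun a => aff (pi1 D) a.1 a.2 l) f) /\
        (exists f, affine_morphism (square_bundle (pi2 D) (pi1 D) (pi2' D))
                     (pi1 D) (fun a => aff (pi2 D) a.1 a.2 l) f)].

Definition restr_dbundle (D : dbundle) (U : set (base D)) : dbundle :=
  let S := (pi1' D \o pi2 D) @^-1` U in
  let S1 := pi2' D @^-1` U in
  let S2 := pi1' D @^-1` U in
  @DBundle (restr S) (restr S1) (restr S2) (restr U)
    (@Bundle (restr S) (restr S1) (pi1 D) (aff (pi1 D)))
    (@Bundle (restr S) (restr S2) (pi2 D) (aff (pi2 D)))
    (@Bundle (restr S2) (restr U) (pi1' D) (aff (pi1' D)))
    (@Bundle (restr S1) (restr U) (pi2' D) (aff (pi2' D))).

(** U x K1 x K2 x K with [K1], [K2], [K] the spaces R^n1, R^n2, R^n. *)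
Definition trivial_dbundle (U : space R) (n1 n2 n : nat) : dbundle :=
  let UK1 := prod_space U (whole (euclidean R n1)) in
  let UK2 := prod_space U (whole (euclidean R n2)) in
  let T := prod_space (prod_space UK1 (whole (euclidean R n2)))
                      (whole (euclidean R n)) in
  @DBundle T UK1 UK2 U
    (@Bundle T UK1 (fun '(x, y, z, c) => (x, y))
       (fun '(x, y, z, c) '(x', y', z', c') l =>
          (x', y', affR z z' l, affR c c' l)))
    (@Bundle T UK2 (fun '(x, y, z, c) => (x, z))
       (fun '(x, y, z, c) '(x', y', z', c') l =>
          (x', affR y y' l, z', affR c c' l)))
    (trivial_bundle U n2)
    (trivial_bundle U n1).

(** [phi] is an isomorphism of double affine bundles covering [phi0]; the maps
    it induces on the two sides are determined by it. *)
Definition dbundle_iso (D D' : dbundle) (phi : tot D -> tot D')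
    (phi0 : base D -> base D') :=
  diffeo phi /\ diffeo phi0 /\
  exists (phi1 : side1 D -> side1 D') (phi2 : side2 D -> side2 D'),
    [/\ diffeo phi1 /\ diffeo phi2,
        affine_morphism (pi1 D) (pi1 D') phi phi1,
        affine_morphism (pi2 D) (pi2 D') phi phi2,
        affine_morphism (pi1' D) (pi1' D') phi2 phi0 &
        affine_morphism (pi2' D) (pi2' D') phi1 phi0].

Definition smooth_coef (M : space R) (S : set M) (h : M -> R) :=
  @smooth_on R M (real_line R) S h.

End AffineBundles.

(* Main.v *)
Require Import Defs.
From HB Require Import structures.
From mathcomp Require Import all_boot all_order all_algebra.
From mathcomp Require Import all_classical all_reals all_analysis.
From mathcomp Require Import ring lra.

Set Implicit Arguments.
Unset Strict Implicit.
Unset Printing Implicit Defensive.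

Import Order.TTheory GRing.Theory Num.Theory.
Import numFieldNormedType.Exports.
Local Open Scope classical_set_scope.
Local Open Scope ring_scope.

(** A change of coordinates over the base that respects both affine structures
    of a trivial double affine bundle is affine in [(z, c)] for fixed [y] and in
    [(y, c)] for fixed [z]. This alone forces the polynomial form of the
    transition functions ([biaffine_coord]), and the coefficients are smooth
    because they are combinations of values at points with constant coordinates
    ([adapted_chart_transition]). What has to be constructed is therefore a
    chart near each point [x0] of the base.

    Trivialisations of the side bundles provide the coordinates [y] and [z]. For
    the third coordinate, consider first one local section [y] of the first
    side. On the fibre of [p1] over [y x], the projection [p2] is affine and
    onto, so its matrix in a trivialisation of [p1] has full rank; completing it
    to an invertible matrix gives coordinates [(z, c)] on these fibres
    ([slice_exists]). This is done for the section through the origin and for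
    the sections through the basis vectors of the coordinates [y]. Call [tau0 x
    z c] and [tau i x z c] the points so parametrised. In the fibre of [p2] over
    [(x, z)], the vectors [[tau0 x z 0, tau i x z 0]] lift the basis vectors,
    and adding [- sum_i y_i [tau0 x z 0, tau i x z 0]] to a point slides it back
    over the origin, where its coordinate [c] is read off ([slide],
    [local_coords]).

    The resulting chart is affine for [p1] by the interchange law, which says
    that affine combinations for [p1] are morphisms for [p2] ([slide_aff1]). For
    [p2], the slide is affine by construction ([slide_aff2]), but the coordinate
    [c] on the slice over the origin was built from the structure of [p1]. It is
    affine for [p2] as well because the two structures coincide on the common
    fibres of [p1] and [p2] ([aff_agree]): by interchange they have the same
    midpoints, and by continuity equality of midpoints is enough.

    All maps are built from trivialisations and affine combinations, so
    smoothness follows from a calculus of smooth maps that allows arbitrary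
    subsets as domains; it reduces, through charts, to the chain rule for
    functions of class C^k. *)

(** * Differentiability of functions of class C^1 *)

Section ScalarCalculus.
Variable R : realType.

Lemma line_increment_le n (g : 'rV[R]_n -> R) (q e : 'rV[R]_n) (s C : R) :
  (forall t : R, `|t| <= `|s| -> derivable g (t *: e + q) e /\
     `|'D_e g (t *: e + q)| <= C) ->
  `|g (s *: e + q) - g q| <= C * `|s|.
Proof.
move=> H; pose phi (t : R) := g (t *: e + q).
have dphi (t : R) : `|t| <= `|s| -> is_derive (t : R^o) 1 phi ('D_e g (t *: e + q)).
  move=> /H[dg _].
  have E : (fun h : R => h^-1 *: ((phi \o shift t) (h *: (1 : R^o)) - phi t)) =
           (fun h : R => h^-1 *: ((g \o shift (t *: e + q)) (h *: e)
                                  - g (t *: e + q))).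
    by apply/funext => h; rewrite /= /phi [h%:A]mulr1 scalerDl addrA.
  by apply: DeriveDef; rewrite /derivable /derive E.
have cphi a b : (forall t, t \in `[a, b] -> `|t| <= `|s|) ->
    {within `[a, b], continuous phi}.
  move=> Hab; apply: derivable_within_continuous => t /Hab /dphi [].
  by [].
have [s0|s0] := leP 0 s.
- have Hab t : t \in `[0, s] -> `|t| <= `|s|.
    by rewrite in_itv /= => /andP[t0 ts]; rewrite !ger0_norm.
  have Hd t : t \in `]0, s[ -> is_derive (t : R^o) 1 phi ('D_e g (t *: e + q)).
    by move=> /subset_itv_oo_cc /Hab /dphi.
  have [c /Hab cs E] := MVT_segment s0 Hd (cphi _ _ Hab).
  have := E; rewrite /phi scale0r add0r subr0 => ->.
  by rewrite normrM ler_wpM2r// (H _ cs).2.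
- have Hab t : t \in `[s, 0] -> `|t| <= `|s|.
    by rewrite in_itv /= => /andP[t0 ts]; rewrite !ler0_norm ?lerN2// ltW.
  have Hd t : t \in `]s, 0[ -> is_derive (t : R^o) 1 phi ('D_e g (t *: e + q)).
    by move=> /subset_itv_oo_cc /Hab /dphi.
  have [c /Hab cs E] := MVT_segment (ltW s0) Hd (cphi _ _ Hab).
  have := E; rewrite /phi scale0r add0r sub0r distrC => ->.
  by rewrite normrM normrN ler_wpM2r// (H _ cs).2.
Qed.

Lemma coord_norm_le n (p : 'rV[R]_n) j : `|p 0 j| <= `|p|.
Proof.
rewrite [leRHS]/Num.Def.normr/= mx_normrE.
exact: (le_bigmax _ (fun i : 'I_1 * 'I_n => `|p i.1 i.2|) (0, j)).
Qed.

Lemma norm_le_coord n (p : 'rV[R]_n) e : 0 <= e ->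
  (forall j, `|p 0 j| <= e) -> `|p| <= e.
Proof.
move=> e0 H; rewrite [leLHS]/Num.Def.normr/= mx_normrE.
by rewrite (bigmax_le _ e0)//= => -[i j] _; rewrite ord1.
Qed.

Lemma differentiable_small (V W : normedModType R) (g : V -> W) (y : V) :
  (forall e : R, 0 < e -> \forall h \near (0 : V),
      `|g (h + y) - g y| <= e * `|h|) ->
  differentiable g y.
Proof.
move=> H; pose z : {linear V -> W} := \0.
have E : g \o shift y = cst (g y) + z +o_ 0 id.
  apply/eqaddoP => e e0; near=> h.
  rewrite /= addr0; near: h; exact: H.
have c0 : continuous z by move=> x; exact: cvg_cst.
have E0 := diff_unique c0 E.
by apply/diff_locallyP; rewrite E0; split.
Unshelve. all: by end_near. Qed.

(** The linear part is subtracted first, so that all partial derivatives vanish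
    at [y]. The increment is then the sum of its increments along the coordinate
    axes, each small by the mean value theorem. *)
Lemma C1_differentiable n (U : set 'rV[R]_n) (g : 'rV[R]_n -> R) y :
  open U -> U y ->
  (forall x v, U x -> derivable g x v) ->
  (forall v, {for y, continuous ('D_v g)}) ->
  differentiable g y.
Proof.
move=> oU Uy dg cg.
pose c j := 'D_('e_j) g y.
pose l := \sum_(j < n) (fun x : 'rV[R]_n => c j *: (x 0 j : R)).
have dl x : differentiable l x.
  by apply: differentiable_sum => j; apply: differentiableZ;
      exact: differentiable_coord.
pose g' : 'rV[R]_n -> R := g - l.
suff dgl : differentiable g' y.
  by rewrite -(subrK l g); apply: differentiableD.
have Dl j x : 'D_('e_j) l x = c j.
  rewrite /derive.
  have lE z : l z = \sum_i c i * z 0 i.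
    by rewrite /l fct_sumE.
  apply: cvg_lim => //=.
  apply: (@cvg_trans _ (cst (c j) @ (0 : R)^')); last exact: cvg_cst.
  apply: near_eq_cvg; near=> h.
  have h0 : h != 0 by near: h; exact: nbhs_dnbhs_neq.
  rewrite /= !lE -sumrB (bigD1 j)//= big1 => [|i ij]; last first.
    by rewrite !mxE (negbTE ij) mulr0 add0r subrr.
  by rewrite !mxE !eqxx mulr1 addr0 mulrDr addrK -[_ *: _]/(_ * _) mulrCA mulVf//
      mulr1.
have dg' x v : U x -> derivable g' x v.
  by move=> Ux; apply: derivableB; [exact: dg|exact: diff_derivable].
have Dg' x j : U x -> 'D_('e_j) g' x = 'D_('e_j) g x - c j.
  by move=> Ux; rewrite deriveB ?Dl//; [exact: dg|exact: diff_derivable].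
move: g' dg' Dg' => g' dg' Dg'.
apply: differentiable_small => e e0.
have en : 0 < e / n.+1%:R by rewrite divr_gt0.
have near1 : \forall x \near y, U x /\
    forall j, `|'D_('e_j) g x - c j| <= e / n.+1%:R.
  near=> x; split; first by near: x; exact: open_nbhs_nbhs.
  move=> j; rewrite distrC; move: j; near: x.
  apply: filter_forall => i.
  by have /cvgrPdist_le := cg 'e_i; apply.
have /nbhs_ballP[r /= r0 Hr] := near1.
near=> h.
have hr : `|h| < r.
  near: h; apply/nbhs_ballP; exists r => //= z.
  by rewrite -ball_normE /= sub0r normrN.
have Hx p : `|p| <= `|h| -> U (p + y) /\
    forall j, `|'D_('e_j) g' (p + y)| <= e / n.+1%:R.
  move=> ph; have /Hr [Up Hp] : ball y r (p + y).
    rewrite -ball_normE /= opprD addrCA subrr addr0 normrN.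
    exact: le_lt_trans hr.
  by split=> // j; rewrite Dg'.
(* The path from 0 to [h] that changes one coordinate at a time. *)
pose hh (i : nat) : 'rV[R]_n := \row_j (if (j < i)%N then h 0 j else 0).
have hhS (i : 'I_n) : hh i.+1 = h 0 i *: 'e_i + hh i.
  apply/rowP => j; rewrite !mxE eqxx /=; have [->|ji] := eqVneq j i.
    by rewrite ltnn ltnSn mulr1 addr0.
  by rewrite mulr0 add0r ltnS leq_eqVlt -[(j == i :> nat)]/(j == i) (negbTE ji).
have E : g' (h + y) - g' y = \sum_(i < n) (g' (hh i.+1 + y) - g' (hh i + y)).
  rewrite -(big_mkord xpredT (fun i => g' (hh i.+1 + y) - g' (hh i + y))).
  rewrite telescope_sumr//; congr (g' _ - g' _).
    by congr (_ + y); apply/rowP => j; rewrite mxE ltn_ord.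
  by rewrite (_ : hh 0%N = 0) ?add0r//; apply/rowP => j; rewrite !mxE.
rewrite [leLHS](_ : _ = `|\sum_(i < n) (g' (hh i.+1 + y) - g' (hh i + y))|);
    last first.
  by rewrite -E.
apply: le_trans (ler_norm_sum _ _ _) _.
apply: (@le_trans _ _ (\sum_(i < n) (e / n.+1%:R * `|h|))); last first.
  rewrite sumr_const card_ord -mulrnAl ler_wpM2r// -mulr_natr -mulrA ler_piMr
      ?(ltW e0)//.
  by rewrite mulrC ler_pdivrMr ?mul1r ?ler_nat// ltr0n.
apply: ler_sum => i _; rewrite hhS -addrA.
apply: (@le_trans _ _ (e / n.+1%:R * `|h 0 i|)); last first.
  by rewrite ler_wpM2l ?coord_norm_le// ltW.
apply: line_increment_le.
move=> t ht; rewrite addrA.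
have /Hx[] : `|t *: 'e_i + hh i| <= `|h|.
  apply: norm_le_coord => // j; rewrite !mxE eqxx /=.
  case: (eqVneq j i) => [->|ji].
    by rewrite ltnn mulr1 addr0 (le_trans ht) ?coord_norm_le.
  rewrite mulr0 add0r; case: ifP => _; rewrite ?normr0 ?coord_norm_le//.
by move=> Up Hp; split; [exact: dg'|exact: Hp].
Unshelve. all: by end_near. Qed.

End ScalarCalculus.

(** * Functions of class C^k in Euclidean space *)

Section ScalarCk.
Variable R : realType.

(** [class_C] for scalar functions. Sums, products, inverses and compositions
    are treated here, where derivatives are numbers; [class_CP] transfers the
    results to vector-valued functions componentwise. *)
Fixpoint Ck (m k : nat) (U : set 'rV[R]_m) (h : 'rV[R]_m -> R) : Prop :=
  (forall x, U x -> {for x, continuous h}) /\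
  if k is k'.+1 then
    forall v : 'rV[R]_m,
      (forall x, U x -> derivable h x v) /\ Ck k' U (fun x => 'D_v h x)
  else True.

Lemma Ck_continuous m k (U : set 'rV[R]_m) h x :
  Ck k U h -> U x -> {for x, continuous h}.
Proof. by case: k => [|k] [ch _]; exact: ch. Qed.

Lemma Ck_pred m k (U : set 'rV[R]_m) h : Ck k.+1 U h -> Ck k U h.
Proof.
elim: k h => [|k IH] h [ch dh]; split=> // v.
by have [d1 d2] := dh v; split=> //; exact: IH.
Qed.

Lemma open_near (T : topologicalType) (U : set T) (P : T -> Prop) x :
  open U -> U x -> (forall y, U y -> P y) -> \forall y \near x, P y.
Proof. by move=> oU Ux H; near=> y; apply: H; near: y; exact: open_nbhs_nbhs.
Unshelve. all: by end_near. Qed.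

Lemma continuous_near_eq (T S : topologicalType) (f g : T -> S) x :
  (\forall y \near x, f y = g y) ->
  {for x, continuous f} -> {for x, continuous g}.
Proof.
move=> fg cf; have E : g x = f x by rewrite (nbhs_singleton fg).
rewrite /prop_for /continuous_at E.
by apply: cvg_trans cf; apply: near_eq_cvg.
Qed.

Lemma Ck_eq m k (U : set 'rV[R]_m) f g : open U ->
  (forall x, U x -> f x = g x) -> Ck k U f -> Ck k U g.
Proof.
move=> oU; elim: k f g => [|k IH] f g fg /= [cf df].
  split=> // x Ux; apply: continuous_near_eq (cf x Ux).
  exact: open_near oU Ux fg.
split=> [x Ux|v]; first by apply: continuous_near_eq (cf x Ux);
    exact: open_near oU Ux fg.
have [d1 d2] := df v; split=> [x Ux|].
  by apply: near_eq_derivable (d1 x Ux); exact: open_near oU Ux fg.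
by apply: IH d2 => x Ux; apply: near_eq_derive; exact: open_near oU Ux fg.
Qed.

Lemma Ck_cst m k (U : set 'rV[R]_m) (c : R) : Ck k U (fun=> c).
Proof.
have cc c' x : {for x, continuous ((fun=> c') : 'rV[R]_m -> R)}.
  exact: (@cst_continuous _ _ c' x).
elim: k c => [|k IH] c /=; split=> // v.
split=> [x _|]; first exact: derivable_cst.
have -> : (fun x => 'D_v ((fun=> c) : 'rV[R]_m -> R) x) = fun=> 0.
  by apply/funext => x; exact: derive_cst.
exact: IH.
Qed.

Lemma Ck_coord m k (U : set 'rV[R]_m) j : Ck k U (fun x => x 0 j).
Proof.
have cc x : {for x, continuous (fun z : 'rV[R]_m => z 0 j)}.
  exact: coord_continuous.
have dc x v : derivable (fun z : 'rV[R]_m => z 0 j) x v.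
  by apply: diff_derivable; exact: differentiable_coord.
have Dc x v : 'D_v (fun z : 'rV[R]_m => z 0 j) x = v 0 j.
  have /(@derive_mx _ _ 1 m id x v) : derivable (id : 'rV[R]_m -> _) x v.
    exact: derivable_id.
  by rewrite derive_id => /rowP /(_ j); rewrite mxE.
case: k => [|k] /=; split=> // v; split=> // .
have -> : (fun x => 'D_v (fun z : 'rV[R]_m => z 0 j) x) = fun=> v 0 j.
  by apply/funext => x.
exact: Ck_cst.
Qed.

Lemma Ck_add m k (U : set 'rV[R]_m) f g : open U ->
  Ck k U f -> Ck k U g -> Ck k U (fun x => f x + g x).
Proof.
move=> oU; elim: k f g => [|k IH] f g [cf df] [cg dg] /=.
  split=> // x Ux; apply: continuousD; [exact: cf|exact: cg].
split=> [x Ux|v]; first by apply: continuousD; [exact: cf|exact: cg].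
have [df1 df2] := df v; have [dg1 dg2] := dg v.
split=> [x Ux|]; first by apply: derivableD; auto.
apply: Ck_eq (IH _ _ df2 dg2) => // x Ux; rewrite -deriveD//; auto.
Qed.

(** By induction on the order: Leibniz' rule writes the derivative as a sum of
    products of functions of class C^k. *)
Lemma Ck_mul m k (U : set 'rV[R]_m) f g : open U ->
  Ck k U f -> Ck k U g -> Ck k U (fun x => f x * g x).
Proof.
move=> oU; elim: k f g => [|k IH] f g Cf Cg.
  have [[cf df] [cg dg]] := (Cf, Cg).
  split=> // x Ux; apply: (@continuousM R _ f g); [exact: cf|exact: cg].
have [[cf df] [cg dg]] := (Cf, Cg).
split=> [x Ux|v]; first by apply: (@continuousM R _ f g); [exact: cf|exact: cg].
have [df1 df2] := df v; have [dg1 dg2] := dg v.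
split=> [x Ux|]; first by apply: derivableM; auto.
have H := Ck_add oU (IH _ _ (Ck_pred Cf) dg2) (IH _ _ (Ck_pred Cg) df2).
apply: Ck_eq H => // x Ux; rewrite deriveM//; auto.
Qed.

Lemma Ck_sum m k (U : set 'rV[R]_m) (I : Type) (r : seq I) (P : pred I)
    (F : I -> 'rV[R]_m -> R) : open U -> (forall i, P i -> Ck k U (F i)) ->
  Ck k U (fun x => \sum_(i <- r | P i) F i x).
Proof.
move=> oU HF; elim: r => [|i r IH].
  by apply: Ck_eq (Ck_cst k U 0) => // x _; rewrite big_nil.
have [Pi|nPi] := boolP (P i).
  by apply: Ck_eq (Ck_add oU (HF _ Pi) IH) => // x _; rewrite big_cons Pi.
by apply: Ck_eq IH => // x _; rewrite big_cons (negbTE nPi).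
Qed.

Lemma Ck_inv m k (U : set 'rV[R]_m) h : open U ->
  (forall x, U x -> h x != 0) -> Ck k U h -> Ck k U (fun x => (h x)^-1).
Proof.
move=> oU h0; have cV x : U x -> {for x, continuous h} ->
    {for x, continuous (fun x => (h x)^-1)}.
  by move=> Ux ch; apply: (@continuousV R _ h) => //; exact: h0.
elim: k => [|k IH] Ch; have [ch dh] := Ch.
  by split=> // x Ux; apply: cV => //; exact: ch.
split=> [x Ux|v]; first by apply: cV => //; exact: ch.
have [d1 d2] := dh v; split=> [x Ux|].
  by apply: (@derivableV _ _ h); auto.
have CV := IH (Ck_pred Ch).
have H := Ck_mul oU (Ck_mul oU CV CV) (Ck_mul oU (Ck_cst k U (-1)) d2).
apply: Ck_eq H => // x Ux; rewrite deriveV; auto.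
by rewrite -[_ *: _]/(_ * _) expr2 invfM; ring.
Qed.

(** Directional derivability of [f] suffices for the inner map, since only its
    restriction to the line through [x] along [v] matters; full
    differentiability of [g] comes from [C1_differentiable]. *)
Lemma derive_comp_coord m n (U : set 'rV[R]_n) (g : 'rV[R]_n -> R)
    (f : 'rV[R]_m -> 'rV[R]_n) x v : open U -> Ck 1 U g -> U (f x) ->
  (forall j, derivable (fun x => f x 0 j) x v) ->
  derivable (g \o f) x v /\
  'D_v (g \o f) x = \sum_j 'D_v (fun x => f x 0 j) x * 'D_('e_j) g (f x).
Proof.
move=> oU [cg dg] Ufx df.
have gd : differentiable g (f x).
  apply: (C1_differentiable oU Ufx) => [y w Uy|w].
    exact: (dg w).1.
  exact: (dg w).2.1 _ Ufx.
have dfx : derivable f x v by apply/derivable_mxP => i j; rewrite ord1.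
pose c : R -> 'rV[R]_n := fun h => f (h *: v + x).
have c0 : c 0 = f x by rewrite /c scale0r add0r.
have dc : differentiable c 0 by apply/derivable1_diffP/(derivable1P f x v).1.
have gd' : differentiable g (c 0) by rewrite c0.
have E : g \o c = (fun h : R => (g \o f) (h *: v + x)) by [].
have dgc : differentiable (g \o c) 0 by exact: differentiable_comp.
have D1 : derivable (g \o f) x v.
  by apply/derivable1P/derivable1_diffP.
have DE (W : normedModType R) (F : 'rV[R]_m -> W) :
    'D_v F x = 'D_1 (fun h : R => F (h *: v + x)) (0 : R^o).
  have Ef : (fun h : R => h^-1 *: ((F \o shift x) (h *: v) - F x)) =
      (fun h : R => h^-1 *: (((fun h : R => F (h *: v + x)) \o shift (0 : R^o))
         (h *: (1 : R^o)) - F ((0 : R) *: v + x))).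
    by apply/funext => h; rewrite /= addr0 scale0r add0r [h%:A]mulr1.
  by rewrite /derive Ef.
split=> //; rewrite DE -E deriveE// diff_comp//= c0.
rewrite -[X in 'd g _ X]deriveE// -[c]/(fun h => f (h *: v + x)) -DE.
have -> : 'D_v f x = \sum_j 'D_v (fun x => f x 0 j) x *: 'e_j.
  rewrite derive_mx// [LHS]row_sum_delta.
  by apply: eq_bigr => j _; rewrite mxE.
rewrite linear_sum; apply: eq_bigr => j _.
by rewrite linearZ /= -deriveE.
Qed.

Lemma continuous_coordP (T : topologicalType) n (f : T -> 'rV[R]_n) x :
  {for x, continuous f} <->
  (forall j, {for x, continuous (fun x => f x 0 j)}).
Proof.
split=> [cf j|H].
  apply: (@continuous_comp _ _ _ f (fun z : 'rV[R]_n => z 0 j)) => //.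
  exact: coord_continuous.
apply/cvgrPdist_lt => e e0; near=> z.
apply: (@le_lt_trans _ _ (e / 2)); last by lra.
apply: norm_le_coord => [|j]; first by lra.
rewrite !mxE; move: j; near: z; apply: filter_forall => j.
by have /cvgrPdist_le := H j; apply; lra.
Unshelve. all: by end_near. Qed.

(** The chain rule expresses each derivative of the composite by products of
    derivatives of [f] with composites of lower order. *)
Lemma Ck_comp m n k (U : set 'rV[R]_m) (V : set 'rV[R]_n) g
    (f : 'rV[R]_m -> 'rV[R]_n) : open U -> open V ->
  (forall x, U x -> V (f x)) ->
  (forall j, Ck k U (fun x => f x 0 j)) -> Ck k V g -> Ck k U (g \o f).
Proof.
move=> oU oV UV.
have cmp k' g' : (forall j, Ck k' U (fun x => f x 0 j)) -> Ck k' V g' ->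
    forall x, U x -> {for x, continuous (g' \o f)}.
  move=> Cf Cg x Ux; apply: continuous_comp; last exact: Ck_continuous Cg (UV _ Ux).
  by apply/continuous_coordP => j; exact: Ck_continuous (Cf j) Ux.
elim: k g => [|k IH] g Cf Cg.
  by split=> // x Ux; exact: cmp Cf Cg x Ux.
split=> [x Ux|v]; first exact: cmp Cf Cg x Ux.
have C1g : Ck 1 V g.
  have [cg dg] := Cg; split=> // w; have [d1 d2] := dg w; split=> //.
  by split=> // x Vx; exact: Ck_continuous d2 Vx.
have df x j : U x -> derivable (fun x => f x 0 j) x v.
  by have [_ /(_ v)[d1 _]] := Cf j; exact: d1.
split=> [x Ux|].
  by have [] := @derive_comp_coord _ _ V g f x v oV C1g (UV _ Ux)
      (fun j => df x j Ux).
apply: (@Ck_eq _ _ _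
    (fun x => \sum_j 'D_v (fun x => f x 0 j) x * ('D_('e_j) g \o f) x)) => //.
  move=> x Ux.
  by have [_ ->] := @derive_comp_coord _ _ V g f x v oV C1g (UV _ Ux)
      (fun j => df x j Ux).
apply: Ck_sum => // j _; apply: Ck_mul => //.
  by have [_ /(_ v)[_ d2]] := Cf j.
apply: IH => [i|]; first exact: Ck_pred.
by have [_ /(_ 'e_j)[_ d2]] := Cg.
Qed.

Lemma class_CP m n k (U : set 'rV[R]_m) (f : 'rV[R]_m -> 'rV[R]_n) :
  open U -> class_C k U f <-> forall j, Ck k U (fun x => f x 0 j).
Proof.
move=> oU; split.
- elim: k f => [|k IH] f [cf df] j.
    by split=> // x Ux; exact: (continuous_coordP _ _).1 (cf x Ux) j.
  split=> [x Ux|v]; first exact: (continuous_coordP _ _).1 (cf x Ux) j.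
  have [d1 d2] := df v.
  have dx x : U x -> derivable (fun x => f x 0 j) x v.
    by move=> /d1 /derivable_mxP.
  split=> //; apply: Ck_eq (IH _ d2 j) => // x Ux.
  by rewrite derive_mx ?mxE//; exact: d1.
- elim: k f => [|k IH] f Cf.
    split=> // x Ux; apply/continuous_coordP => j.
    exact: Ck_continuous (Cf j) Ux.
  split=> [x Ux|v].
    by apply/continuous_coordP => j; exact: Ck_continuous (Cf j) Ux.
  have d1 x : U x -> derivable f x v.
    move=> Ux; apply/derivable_mxP => i j; rewrite ord1.
    by have [_ /(_ v)[d1 _]] := Cf j; exact: d1.
  split=> //; apply: IH => j; have [_ /(_ v)[_ d2]] := Cf j.
  by apply: Ck_eq d2 => // x Ux; rewrite derive_mx ?mxE//; exact: d1.
Qed.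

End ScalarCk.

Section ClassC.
Variable R : realType.

Lemma class_C_sub m n k (U V : set 'rV[R]_m) (f : 'rV[R]_m -> 'rV[R]_n) :
  V `<=` U -> class_C k U f -> class_C k V f.
Proof.
move=> VU; elim: k f => [|k IH] f /= [cf df].
  by split=> // x /VU; exact: cf.
split=> [x /VU|v]; first exact: cf.
by have [d1 d2] := df v; split=> [x /VU|]; [exact: d1|exact: IH].
Qed.

Lemma class_C_local m n k (U : set 'rV[R]_m) (f : 'rV[R]_m -> 'rV[R]_n) :
  (forall x, U x -> exists2 V, V x & class_C k V f) -> class_C k U f.
Proof.
elim: k f => [|k IH] f H /=.
  by split=> // x /H[V Vx [cf _]]; exact: cf.
split=> [x /H[V Vx [cf _]]|v]; first exact: cf.
split=> [x /H[V Vx [_ /(_ v)[df _]]]|]; first exact: df.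
by apply: IH => x /H[V Vx [_ /(_ v)[_ df]]]; exists V.
Qed.

Lemma class_C_eq m n k (U : set 'rV[R]_m) (f g : 'rV[R]_m -> 'rV[R]_n) :
  open U -> (forall x, U x -> f x = g x) -> class_C k U f -> class_C k U g.
Proof.
move=> oU fg /class_CP-/(_ oU) H; apply/class_CP => // j.
by apply: Ck_eq (H j) => // x /fg ->.
Qed.

Lemma class_C_comp l m n k (U : set 'rV[R]_l) (V : set 'rV[R]_m)
    (g : 'rV[R]_m -> 'rV[R]_n) (f : 'rV[R]_l -> 'rV[R]_m) :
  open U -> open V -> (forall x, U x -> V (f x)) ->
  class_C k U f -> class_C k V g -> class_C k U (g \o f).
Proof.
move=> oU oV UV /class_CP-/(_ oU) Cf /class_CP-/(_ oV) Cg.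
apply/class_CP => // j.
exact: (Ck_comp (g := fun y => g y 0 j) (f := f) oU oV UV Cf (Cg j)).
Qed.

Lemma class_C_row m n1 n2 k (U : set 'rV[R]_m) (f : 'rV[R]_m -> 'rV[R]_n1)
    (g : 'rV[R]_m -> 'rV[R]_n2) : open U ->
  class_C k U f -> class_C k U g -> class_C k U (fun x => row_mx (f x) (g x)).
Proof.
move=> oU /class_CP-/(_ oU) Cf /class_CP-/(_ oU) Cg.
apply/class_CP => // j.
case: (split_ordP j) => i ->.
  by apply: Ck_eq (Cf i) => // x _; rewrite row_mxEl.
by apply: Ck_eq (Cg i) => // x _; rewrite row_mxEr.
Qed.

Lemma class_C_lsubmx m n k (U : set 'rV[R]_(m + n)) : open U ->
  class_C k U (@lsubmx R 1 m n).
Proof.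
move=> oU; apply/class_CP => // j.
by apply: Ck_eq (Ck_coord k U (lshift n j)) => // x _; rewrite mxE.
Qed.

Lemma class_C_rsubmx m n k (U : set 'rV[R]_(m + n)) : open U ->
  class_C k U (@rsubmx R 1 m n).
Proof.
move=> oU; apply/class_CP => // j.
by apply: Ck_eq (Ck_coord k U (rshift m j)) => // x _; rewrite mxE.
Qed.

Lemma lsubmx_continuous m n : continuous (@lsubmx R 1 m n).
Proof.
have [] := (@class_C_lsubmx m n 0 setT openT); move=> H _ x; exact: H.
Qed.

Lemma rsubmx_continuous m n : continuous (@rsubmx R 1 m n).
Proof.
have [] := (@class_C_rsubmx m n 0 setT openT); move=> H _ x; exact: H.
Qed.

Lemma row_mx_continuous (T : topologicalType) m n (f : T -> 'rV[R]_m)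
    (g : T -> 'rV[R]_n) x : {for x, continuous f} -> {for x, continuous g} ->
  {for x, continuous (fun x => row_mx (f x) (g x))}.
Proof.
move=> /continuous_coordP cf /continuous_coordP cg; apply/continuous_coordP => j.
case: (split_ordP j) => i ->.
  by rewrite (_ : (fun x => _) = fun x => f x 0 i)//; apply/funext => y;
      rewrite row_mxEl.
by rewrite (_ : (fun x => _) = fun x => g x 0 i)//; apply/funext => y;
    rewrite row_mxEr.
Qed.

End ClassC.

Section Topology.

Lemma open_preimage (X Y : topologicalType) (f : X -> Y) (W : set X) (N : set Y) :
  open W -> open N -> (forall x, W x -> {for x, continuous f}) ->
  open (W `&` f @^-1` N).
Proof.
move=> oW oN cf; rewrite openE => x [Wx Nfx]; rewrite /interior.
near=> y; split; first by near: y; exact: open_nbhs_nbhs.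
by near: y; apply: (cf x Wx); exact: open_nbhs_nbhs.
Unshelve. all: by end_near. Qed.

Lemma pair_continuous (X Y Z : topologicalType) (f : X -> Y) (g : X -> Z) x :
  {for x, continuous f} -> {for x, continuous g} ->
  {for x, continuous (fun x => (f x, g x))}.
Proof. by move=> cf cg; apply: cvg_pair. Qed.

Lemma continuous_fst (X Y : topologicalType) : continuous (@fst X Y).
Proof. by move=> [x y]; exact: cvg_fst. Qed.

Lemma continuous_snd (X Y : topologicalType) : continuous (@snd X Y).
Proof. by move=> [x y]; exact: cvg_snd. Qed.

End Topology.

(** * Smooth maps between charted spaces *)

Section Manifolds.
Variable R : realType.
Implicit Types X Y Z : charted_space R.

(** The part of [smooth_manifold] on which the calculus of smooth maps rests. It
    is stable under products, hence a class: the hypotheses on iterated products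
    are found by inference. *)
Class charted X : Prop := Charted {
  chart_cover : forall x : X, exists2 u, atlas u & cdom u x;
  atlas_chart : forall u, @atlas _ X u -> is_chart u;
  chart_change : forall u v, @atlas _ X u -> atlas v ->
    Cinfty (cmap u @` (cdom u `&` cdom v)) (cmap v \o cinv u) }.

Lemma smooth_manifold_charted X : smooth_manifold X -> charted X.
Proof. by case. Qed.

Lemma chart_open (X : topologicalType) n (u : chart R X n) (W : set X) :
  is_chart u -> open W -> open (cmap u @` (W `&` cdom u)).
Proof.
move=> [od oi uK _ cv] oW.
rewrite (_ : _ @` _ = (cmap u @` cdom u) `&` cinv u @^-1` W).
  exact: open_preimage.
apply/seteqP; split=> [w [x [Wx ux] <-]|w [[x ux <-]]] /=.
  by rewrite uK//; split=> //; exists x.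
by rewrite uK// => Wx; exists x.
Qed.

Lemma smooth_on_open_continuous X Y (W : set X) (f : X -> Y) x :
  smooth_on_open W f -> W x -> {for x, continuous f}.
Proof. by move=> [cf _]; exact: cf. Qed.

Lemma smooth_on_open_sub X Y (W W' : set X) (f : X -> Y) :
  W' `<=` W -> smooth_on_open W f -> smooth_on_open W' f.
Proof.
move=> WW [cf df]; split=> [x /WW|u v uA vA k]; first exact: cf.
apply: class_C_sub (df u v uA vA k).
by move=> w [x [[/WW Wx ux] vx] <-]; exists x.
Qed.

Lemma atlas_open X {mX : charted X} u : @atlas _ X u -> open (cdom u).
Proof. by move=> /atlas_chart[]. Qed.

Lemma cinvK X {mX : charted X} u (x : X) : atlas u -> cdom u x ->
  cinv u (cmap u x) = x.
Proof. by move=> /atlas_chart[_ _ uK _ _]; exact: uK. Qed.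

(** Near a point, the composite read in charts of [X] and [Z] factors through
    any chart of [Y] around the intermediate point. *)
Lemma smooth_on_open_comp X Y Z {mX : charted X} {mY : charted Y}
    {mZ : charted Z} (W : set X)
    (W' : set Y) (f : X -> Y) (g : Y -> Z) :
  open W -> open W' -> smooth_on_open W f -> smooth_on_open W' g ->
  smooth_on_open (W `&` f @^-1` W') (g \o f).
Proof.
move=> oW oW' [cf Cf] [cg Cg]; split=> [x [Wx Wfx]|].
  by apply: continuous_comp; [exact: cf|exact: cg].
move=> u v uA vA k; apply: class_C_local => w [x [[[Wx Wfx] ux] vx] <-].
have [t tA tfx] := chart_cover (f x).
have oN : open (W' `&` cdom t `&` g @^-1` cdom v).
  apply: open_preimage; [exact: openI oW' (atlas_open tA)|exact: atlas_open|].
  by move=> y [Wy _]; exact: cg.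
have oWN := open_preimage oW oN cf.
have oO := chart_open (atlas_chart uA) oWN.
have oV : open (cmap t @` (W' `&` cdom t `&` g @^-1` cdom v)).
  rewrite setIAC; apply: chart_open; first exact: atlas_chart.
  by apply: open_preimage => //; exact: atlas_open.
exists (cmap u @` ((W `&` f @^-1` (W' `&` cdom t `&` g @^-1` cdom v)) `&` cdom u)).
  by exists x.
have C1 := class_C_sub _ (Cf u t uA tA k).
have {}C1 := C1 (cmap u @` ((W `&` f @^-1` (W' `&` cdom t `&` g @^-1` cdom v))
   `&` cdom u)).
apply: (@class_C_eq _ _ _ _ _ ((cmap v \o g \o cinv t) \o (cmap t \o f \o cinv u))).
- exact: oO.
- by move=> _ [y [[Wy [[Wfy tfy] vy]] uy] <-];
    rewrite /= (cinvK uA uy) (cinvK tA tfy).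
apply: class_C_comp (Cg t v tA vA k).
- exact: oO.
- exact: oV.
- by move=> _ [y [[Wy [[Wfy tfy] vy]] uy] <-] /=; rewrite (cinvK uA uy);
    exists (f y).
by apply: C1 => _ [y [[Wy [[Wfy tfy] vy]] uy] <-]; exists y.
Qed.

Lemma smooth_on_open_id X {mX : charted X} : @smooth_on_open R X X setT id.
Proof.
split=> [x _|u v uA vA]; first by [].
by rewrite setTI; exact: chart_change.
Qed.

Lemma smooth_on_open_cst X Y {mX : charted X} {mY : charted Y} (y : Y) :
  @smooth_on_open R X Y setT (fun=> y).
Proof.
split=> [x _|u v uA vA k]; first exact: (@cst_continuous _ _ y x).
rewrite setTI; have oU : open (cmap u @` (cdom u `&` (fun=> y) @^-1` cdom v)).
  rewrite setIC; apply: chart_open; first exact: atlas_chart.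
  by rewrite preimage_cst; case: ifP => _; [exact: openT|exact: open0].
by apply/class_CP => // j; exact: Ck_cst.
Qed.

Lemma is_chart_prod (X Y : topologicalType) m n (u : chart R X m)
    (v : chart R Y n) :
  is_chart u -> is_chart v -> is_chart (chart_prod u v).
Proof.
move=> [odu oiu uK cu ciu] [odv oiv vK cv civ].
have E : cmap (chart_prod u v) @` cdom (chart_prod u v) =
  (@lsubmx R 1 m n @^-1` (cmap u @` cdom u)) `&`
  (@rsubmx R 1 m n @^-1` (cmap v @` cdom v)).
  apply/seteqP; split=> [_ [[x y] [/= ux vy] <-]|w [[x ux xw] [y vy yw]]].
    by rewrite /= row_mxKl row_mxKr; split; [exists x|exists y].
  by exists (x, y) => //=; rewrite xw yw hsubmxK.
split.
- rewrite [cdom _](_ : _ = (@fst X Y @^-1` cdom u) `&` (@snd X Y @^-1` cdom v)).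
    by apply: openI; apply: open_comp => // x _;
        [exact: continuous_fst|exact: continuous_snd].
  by apply/seteqP; split=> [[x y] []|[x y] []].
- rewrite E; apply: openI; apply: open_comp => // x _.
    exact: lsubmx_continuous.
  exact: rsubmx_continuous.
- by move=> [x y] [/= ux vy]; rewrite row_mxKl row_mxKr uK// vK.
- move=> [x y] [/= ux vy]; apply: row_mx_continuous.
    apply: (@continuous_comp _ _ _ fst (cmap u)); first exact: continuous_fst.
    exact: cu.
  apply: (@continuous_comp _ _ _ snd (cmap v)); first exact: continuous_snd.
  exact: cv.
- rewrite E => w [lw rw]; apply: pair_continuous.
    apply: (@continuous_comp _ _ _ _ (cinv u)); first exact: lsubmx_continuous.
    exact: ciu.
  apply: (@continuous_comp _ _ _ _ (cinv v)); first exact: rsubmx_continuous.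
  exact: civ.
Qed.

#[global] Instance product_charted X Y {mX : charted X}
    {mY : charted Y} : charted (product X Y).
Proof.
split.
- move=> [x y]; have [u uA ux] := chart_cover x; have [v vA vy] := chart_cover y.
  by exists (chart_prod u v); first by exists u, v.
- by move=> w [u [v [uA vA ->]]]; apply: is_chart_prod; exact: atlas_chart.
- move=> _ _ [u [v [uA vA ->]]] [u' [v' [uA' vA' ->]]] k.
  have oO : open (cmap (chart_prod u v) @` (cdom (chart_prod u v) `&`
      cdom (chart_prod u' v'))).
    rewrite setIC; apply: chart_open.
      by apply: is_chart_prod; exact: atlas_chart.
    by have [] : is_chart (chart_prod u' v')
      by apply: is_chart_prod; exact: atlas_chart.
  have oU : open (cmap u @` (cdom u `&` cdom u')).
    rewrite setIC; apply: chart_open; first exact: atlas_chart.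
    exact: atlas_open.
  have oV : open (cmap v @` (cdom v `&` cdom v')).
    rewrite setIC; apply: chart_open; first exact: atlas_chart.
    exact: atlas_open.
  apply: (@class_C_row _ _ _ _ _ _
    ((cmap u' \o cinv u) \o lsubmx) ((cmap v' \o cinv v) \o rsubmx)) => //.
  + apply: class_C_comp (class_C_lsubmx _ oO) (chart_change uA uA' k) => //.
    by move=> _ [[x y] [[/= ux vy] [/= ux' vy']] <-]; rewrite row_mxKl; exists x.
  + apply: class_C_comp (class_C_rsubmx _ oO) (chart_change vA vA' k) => //.
    by move=> _ [[x y] [[/= ux vy] [/= ux' vy']] <-]; rewrite row_mxKr; exists y.
Qed.

Lemma Cinfty_id n (U : set 'rV[R]_n) : open U -> Cinfty U id.
Proof. by move=> oU k; apply/class_CP => // j; exact: Ck_coord. Qed.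

#[global] Instance euclidean_charted n : charted (euclidean R n).
Proof.
split.
- by move=> x; exists (Chart setT id id).
- move=> _ ->; split=> //=; rewrite ?image_id;
    [exact: openT|exact: openT|by move=> x _|by move=> x _].
- by move=> _ _ -> ->; apply: Cinfty_id; rewrite /= setTI image_id; exact: openT.
Qed.

Lemma const_mx_continuous : continuous (fun r : R => const_mx r : 'rV[R]_1).
Proof.
move=> r; apply/continuous_coordP => j.
by rewrite (_ : (fun x => _) = id)//; apply/funext => x; rewrite mxE.
Qed.

#[global] Instance real_line_charted : charted (real_line R).
Proof.
have E : [set (fun r : R => const_mx r : 'rV[R]_1) x | x in setT] = setT.
  apply/seteqP; split=> // w _; exists (w 0 0) => //.
  by apply/rowP => j; rewrite mxE ord1.
split.
- by move=> x; exists (Chart setT (fun r : R => const_mx r : 'rV[R]_1)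
                                    (fun v : 'rV[R]_1 => v 0 0)).
- move=> _ ->; split=> //=; rewrite ?E.
  + exact: openT.
  + exact: openT.
  + by move=> x _; rewrite mxE.
  + by move=> x _; exact: const_mx_continuous.
  + by move=> w _; exact: coord_continuous.
- move=> _ _ -> -> k; rewrite /= setTI E; apply/class_CP => [|j].
    exact: openT.
  by apply: Ck_eq (Ck_coord k setT 0) => [|x _]; [exact: openT|rewrite /= mxE].
Qed.

Lemma smooth_on_open_fst X Y {mX : charted X} {mY : charted Y} :
  @smooth_on_open R (product X Y) X setT fst.
Proof.
split=> [x _|_ u' [u [v [uA vA ->]]] uA' k]; first exact: continuous_fst.
set O := _ @` _.
have oO : open O.
  rewrite /O setTI setIC; apply: chart_open.
    by apply: is_chart_prod; exact: atlas_chart.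
  by apply: open_comp; [move=> x _; exact: continuous_fst|exact: atlas_open].
apply: (@class_C_comp _ _ _ _ _ _ _ (cmap u' \o cinv u) lsubmx)
    (class_C_lsubmx _ oO)
  (chart_change uA uA' k) => //.
  rewrite setIC; apply: chart_open; first exact: atlas_chart.
  exact: atlas_open.
by move=> _ [[x y] [[/= _ [ux vy]] ux'] <-]; rewrite row_mxKl; exists x.
Qed.

Lemma smooth_on_open_snd X Y {mX : charted X} {mY : charted Y} :
  @smooth_on_open R (product X Y) Y setT snd.
Proof.
split=> [x _|_ v' [u [v [uA vA ->]]] vA' k]; first exact: continuous_snd.
set O := _ @` _.
have oO : open O.
  rewrite /O setTI setIC; apply: chart_open.
    by apply: is_chart_prod; exact: atlas_chart.
  by apply: open_comp; [move=> x _; exact: continuous_snd|exact: atlas_open].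
apply: (@class_C_comp _ _ _ _ _ _ _ (cmap v' \o cinv v) rsubmx)
    (class_C_rsubmx _ oO)
  (chart_change vA vA' k) => //.
  rewrite setIC; apply: chart_open; first exact: atlas_chart.
  exact: atlas_open.
by move=> _ [[x y] [[/= _ [ux vy]] vy'] <-]; rewrite row_mxKr; exists y.
Qed.

Lemma smooth_on_open_pair X Y Z {mX : charted X} {mY : charted Y}
    {mZ : charted Z} (W : set X)
    (f : X -> Y) (g : X -> Z) : open W ->
  smooth_on_open W f -> smooth_on_open W g ->
  @smooth_on_open R X (product Y Z) W (fun x => (f x, g x)).
Proof.
move=> oW [cf Cf] [cg Cg]; split=> [x Wx|u _ uA [v1 [v2 [vA1 vA2 ->]]] k].
  by apply: pair_continuous; [exact: cf|exact: cg].
set O := _ @` _.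
have oO : open O.
  rewrite /O setIAC; apply: chart_open; first exact: atlas_chart.
  apply: open_preimage => //; last first.
    by move=> x Wx; apply: pair_continuous; [exact: cf|exact: cg].
  by have [] : is_chart (chart_prod v1 v2)
    by apply: is_chart_prod; exact: atlas_chart.
apply: (@class_C_row _ _ _ _ _ _ (cmap v1 \o f \o cinv u)
    (cmap v2 \o g \o cinv u)) => //.
  apply: class_C_sub (Cf u v1 uA vA1 k).
  by move=> _ [x [[Wx ux] [v1x v2x]] <-]; exists x.
apply: class_C_sub (Cg u v2 uA vA2 k).
by move=> _ [x [[Wx ux] [v1x v2x]] <-]; exists x.
Qed.

Lemma real_smoothP X {mX : charted X} (W : set X) (f : X -> R) : open W ->
  @smooth_on_open R X (real_line R) W f <->
  ((forall x, W x -> {for x, continuous f}) /\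
   (forall u k, @atlas _ X u -> Ck k (cmap u @` (W `&` cdom u)) (f \o cinv u))).
Proof.
move=> oW; have oO u : @atlas _ X u -> open (cmap u @` (W `&` cdom u)).
  by move=> uA; apply: chart_open => //; exact: atlas_chart.
split=> [[cf Cf]|[cf Cf]]; split=> //.
  move=> u k uA; have := Cf u _ uA erefl k; rewrite /= preimage_setT setIT.
  move=> /class_CP-/(_ (oO _ uA)) /(_ 0).
  by apply: Ck_eq; [exact: oO|move=> x _; rewrite /= mxE].
move=> u _ uA -> k; rewrite /= preimage_setT setIT.
apply/class_CP => [|j]; first exact: oO.
by apply: Ck_eq (Cf u k uA) => [|x _]; [exact: oO|rewrite /= mxE].
Qed.

Lemma euclidean_smoothP X {mX : charted X} n (W : set X) (f : X ->
    'rV[R]_n) : open W ->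
  @smooth_on_open R X (euclidean R n) W f <->
  forall j, @smooth_on_open R X (real_line R) W (fun x => f x 0 j).
Proof.
move=> oW; have oO u : @atlas _ X u -> open (cmap u @` (W `&` cdom u)).
  by move=> uA; apply: chart_open => //; exact: atlas_chart.
split=> [[cf Cf] j|H].
  apply/real_smoothP => //; split=> [x Wx|u k uA].
    exact: (continuous_coordP _ _).1 (cf x Wx) j.
  have := Cf u _ uA erefl k; rewrite /= preimage_setT setIT.
  by move=> /class_CP-/(_ (oO _ uA)) /(_ j).
split=> [x Wx|u _ uA -> k].
  by apply/continuous_coordP => j; have /real_smoothP-/(_ oW)[cf _] := H j;
      exact: cf.
rewrite /= preimage_setT setIT; apply/class_CP => [|j]; first exact: oO.
by have /real_smoothP-/(_ oW)[_ Cf] := H j; exact: Cf.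
Qed.

End Manifolds.

(** * Smoothness on arbitrary subsets *)

(** [smooth_on] with its two spaces explicit: they are charted spaces, which
    cannot be read off the types of points. *)
Notation smooth_in X Y S f := (@smooth_on _ X Y S f).

Section SmoothOn.
Variable R : realType.
Implicit Types X Y Z : charted_space R.
Local Notation RL := (real_line R).
Local Notation Eu n := (euclidean R n).

Lemma smooth_on_open_smooth X Y (W : set X) (f : X -> Y) : open W ->
  smooth_on_open W f -> smooth_in X Y W f.
Proof. by move=> oW Cf x Wx; exists W, f. Qed.

Lemma smooth_on_sub X Y (S T : set X) (f : X -> Y) : T `<=` S ->
  smooth_in X Y S f -> smooth_in X Y T f.
Proof.
move=> TS Cf x /TS/Cf[W [F [oW Wx FE CF]]]; exists W, F; split=> // y Ty.
by apply: FE; exact: TS.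
Qed.

Lemma smooth_on_eq X Y (S : set X) (f g : X -> Y) : (forall x, S x -> f x = g x) ->
  smooth_in X Y S f -> smooth_in X Y S g.
Proof.
move=> fg Cf x Sx; have [W [F [oW Wx FE CF]]] := Cf x Sx; exists W, F.
by split=> // y Sy Wy; rewrite -fg// FE.
Qed.

Lemma smooth_on_local X Y (S : set X) (f : X -> Y) :
  (forall x, S x -> exists W : set X, [/\ open W, W x & smooth_in X Y
      (S `&` W) f]) ->
  smooth_in X Y S f.
Proof.
move=> H x Sx; have [W [oW Wx Cf]] := H x Sx.
have [W' [F [oW' W'x FE CF]]] := Cf x (conj Sx Wx).
exists (W `&` W'), F; split=> //; first exact: openI.
  by move=> y Sy [Wy W'y]; apply: FE.
exact: smooth_on_open_sub CF.
Qed.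

Lemma smooth_on_near X Y (S : set X) (f : X -> Y) x
    (N : set Y) : smooth_in X Y S f -> S x ->
  open N -> N (f x) ->
  exists W : set X, [/\ open W, W x & forall y, S y -> W y -> N (f y)].
Proof.
move=> Cf Sx oN Nfx; have [W [F [oW Wx FE CF]]] := Cf x Sx.
exists (W `&` F @^-1` N); split.
- by apply: open_preimage => // y Wy; exact: smooth_on_open_continuous CF Wy.
- by split=> //=; rewrite FE.
- by move=> y Sy [Wy] /=; rewrite FE.
Qed.

Lemma smooth_on_continuous X Y (S : set X) (f : X -> Y) x : open S ->
    smooth_in X Y S f ->
  S x -> {for x, continuous f}.
Proof.
move=> oS Cf Sx; have [W [F [oW Wx FE CF]]] := Cf x Sx.
apply: continuous_near_eq (smooth_on_open_continuous CF Wx).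
by apply: (open_near (openI oS oW)) => // y [Sy Wy]; exact: FE.
Qed.

Lemma smooth_on_preimage_open X Y (S : set X) (f : X -> Y) (N : set Y) : open S ->
  smooth_in X Y S f -> open N -> open (S `&` f @^-1` N).
Proof.
by move=> oS Cf oN; apply: open_preimage => // x; exact: smooth_on_continuous.
Qed.

Lemma smooth_on_id X {mX : charted X} (S : set X) : smooth_in X X S id.
Proof. by apply: (smooth_on_sub (S := setT)) => //; apply: smooth_on_open_smooth;
    [exact: openT|exact: smooth_on_open_id]. Qed.

Lemma smooth_on_cst X Y {mX : charted X} {mY : charted Y} (S : set X) (y : Y) :
  smooth_in X Y S (fun=> y).
Proof. by apply: (smooth_on_sub (S := setT)) => //; apply: smooth_on_open_smooth;
    [exact: openT|exact: smooth_on_open_cst]. Qed.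

Lemma smooth_on_const X {mX : charted X} (S : set X) (c : R) : smooth_in X RL S
    (fun=> c).
Proof. exact: (@smooth_on_cst X RL). Qed.

Lemma smooth_on_comp X Y Z {mX : charted X} {mY : charted Y} {mZ : charted Z}
    (S : set X)
    (T : set Y) (f : X -> Y) (g : Y -> Z) :
  (forall x, S x -> T (f x)) -> smooth_in X Y S f -> smooth_in Y Z T g ->
  smooth_in X Z S (fun x => g (f x)).
Proof.
move=> ST Cf Cg x Sx; have [W [F [oW Wx FE CF]]] := Cf x Sx.
have [W' [G [oW' W'x GE CG]]] := Cg _ (ST _ Sx).
exists (W `&` F @^-1` W'), (G \o F); split.
- by apply: open_preimage => // y Wy; exact: smooth_on_open_continuous CF Wy.
- by split=> //=; rewrite FE.
- by move=> y Sy [Wy] /=; rewrite FE// => W'y; rewrite GE//; exact: ST.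
- exact: smooth_on_open_comp.
Qed.

Lemma smooth_on_pair X Y Z {mX : charted X} {mY : charted Y} {mZ : charted Z}
    (S : set X)
    (f : X -> Y) (g : X -> Z) :
  smooth_in X Y S f -> smooth_in X Z S g -> smooth_in X (product Y Z) S
      (fun x => (f x, g x)).
Proof.
move=> Cf Cg x Sx; have [W [F [oW Wx FE CF]]] := Cf x Sx.
have [W' [G [oW' W'x GE CG]]] := Cg _ Sx.
exists (W `&` W'), (fun x => (F x, G x)); split=> //; first exact: openI.
  by move=> y Sy [Wy W'y]; rewrite FE ?GE.
apply: smooth_on_open_pair; first exact: openI.
  by apply: smooth_on_open_sub CF => y [].
by apply: smooth_on_open_sub CG => y [].
Qed.

Lemma smooth_on_fst X Y Z {mX : charted X} {mY : charted Y} {mZ : charted Z}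
    (S : set X)
    (f : X -> Y * Z) : smooth_in X (product Y Z) S f -> smooth_in X Y S
        (fun x => (f x).1).
Proof.
move=> Cf; apply: (@smooth_on_comp X (product Y Z) Y _ _ _ S setT f fst) => //.
by apply: smooth_on_open_smooth; [exact: openT|exact: smooth_on_open_fst].
Qed.

Lemma smooth_on_snd X Y Z {mX : charted X} {mY : charted Y} {mZ : charted Z}
    (S : set X)
    (f : X -> Y * Z) : smooth_in X (product Y Z) S f -> smooth_in X Z S
        (fun x => (f x).2).
Proof.
move=> Cf; apply: (@smooth_on_comp X (product Y Z) Z _ _ _ S setT f snd) => //.
by apply: smooth_on_open_smooth; [exact: openT|exact: smooth_on_open_snd].
Qed.

Lemma smooth_on_coord X {mX : charted X} n (S : set X) (f : X -> 'rV[R]_n) j :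
  smooth_in X (Eu n) S f -> smooth_in X RL S (fun x => f x 0 j).
Proof.
move=> Cf x Sx; have [W [F [oW Wx FE CF]]] := Cf x Sx.
exists W, (fun x => F x 0 j); split=> // [y Sy Wy|]; first by rewrite FE.
by move/euclidean_smoothP : CF; apply.
Qed.

(** Each component has its own local extension; there are finitely many, so they
    live on a common neighbourhood. *)
Lemma smooth_on_row X {mX : charted X} n (S : set X) (f : X -> 'rV[R]_n) :
  (forall j, smooth_in X RL S (fun x => f x 0 j)) -> smooth_in X (Eu n) S f.
Proof.
move=> Cf x Sx.
have /choice[W /choice[F H]] : forall j, exists (W : set X) (F : X -> RL),
  [/\ open W, W x, (forall y, S y -> W y -> F y = f y 0 j) & smooth_on_open W F].
  by move=> j; exact: Cf.
pose V := (fun y => forall j, W j y)°.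
have VW y j : V y -> W j y by move=> /interior_subset; apply.
exists V, (fun x => \row_j F j x); split.
- exact: open_interior.
- apply: filter_forall => j; have [oW Wx _ _] := H j.
  exact: open_nbhs_nbhs.
- move=> y Sy Vy; apply/rowP => j; rewrite mxE.
  by have [_ _ FE _] := H j; apply: FE => //; exact: VW.
- apply/euclidean_smoothP => [|j]; first exact: open_interior.
  rewrite (_ : (fun x => _) = F j); last by apply/funext => y; rewrite mxE.
  by have [_ _ _ CF] := H j; apply: smooth_on_open_sub CF => y; exact: VW.
Qed.

Lemma smooth_on_add X {mX : charted X} (S : set X) (f g : X -> R) :
  smooth_in X RL S f -> smooth_in X RL S g -> smooth_in X RL S (fun x => f x + g x).
Proof.
move=> Cf Cg x Sx; have [W [F [oW Wx FE CF]]] := Cf x Sx.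
have [W' [G [oW' W'x GE CG]]] := Cg _ Sx; have oI := openI oW oW'.
exists (W `&` W'), (fun x => F x + G x); split=> //.
  by move=> y Sy [Wy W'y]; rewrite FE ?GE.
have /real_smoothP-/(_ oI)[cF {}CF] : @smooth_on_open R X RL (W `&` W') F.
  by apply: smooth_on_open_sub CF => y [].
have /real_smoothP-/(_ oI)[cG {}CG] : @smooth_on_open R X RL (W `&` W') G.
  by apply: smooth_on_open_sub CG => y [].
apply/real_smoothP => //; split=> [y Wy|u k uA].
  by apply: continuousD; [exact: cF|exact: cG].
apply: (@Ck_add _ _ _ _ (F \o cinv u) (G \o cinv u)); last exact: CG.
  by apply: chart_open => //; exact: atlas_chart.
exact: CF.
Qed.

Lemma smooth_on_mul X {mX : charted X} (S : set X) (f g : X -> R) :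
  smooth_in X RL S f -> smooth_in X RL S g -> smooth_in X RL S (fun x => f x * g x).
Proof.
move=> Cf Cg x Sx; have [W [F [oW Wx FE CF]]] := Cf x Sx.
have [W' [G [oW' W'x GE CG]]] := Cg _ Sx; have oI := openI oW oW'.
exists (W `&` W'), (fun x => F x * G x); split=> //.
  by move=> y Sy [Wy W'y]; rewrite FE ?GE.
have /real_smoothP-/(_ oI)[cF {}CF] : @smooth_on_open R X RL (W `&` W') F.
  by apply: smooth_on_open_sub CF => y [].
have /real_smoothP-/(_ oI)[cG {}CG] : @smooth_on_open R X RL (W `&` W') G.
  by apply: smooth_on_open_sub CG => y [].
apply/real_smoothP => //; split=> [y Wy|u k uA].
  by apply: (@continuousM R _ F G); [exact: cF|exact: cG].
apply: (@Ck_mul _ _ _ _ (F \o cinv u) (G \o cinv u)); last exact: CG.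
  by apply: chart_open => //; exact: atlas_chart.
exact: CF.
Qed.

Lemma smooth_on_inv X {mX : charted X} (S : set X) (f : X -> R) :
  (forall x, S x -> f x != 0) ->
  smooth_in X RL S f -> smooth_in X RL S (fun x => (f x)^-1).
Proof.
move=> f0 Cf x Sx; have [W [F [oW Wx FE CF]]] := Cf x Sx.
have oN : open (W `&` F @^-1` [set~ 0]).
  apply: open_preimage => //; first by apply: closed_openC; exact: closed_eq.
  by move=> y Wy; exact: smooth_on_open_continuous CF Wy.
exists (W `&` F @^-1` [set~ 0]), (fun x => (F x)^-1); split=> //.
- by split=> //=; rewrite FE//; exact/eqP/f0.
- by move=> y Sy [Wy _]; rewrite FE.
have /real_smoothP-/(_ oN)[cF {}CF] :
    @smooth_on_open R X RL (W `&` F @^-1` [set~ 0]) F.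
  by apply: smooth_on_open_sub CF => y [].
apply/real_smoothP => //; split=> [y Wy|u k uA].
  by apply: (@continuousV R _ F); [case: Wy => _ /eqP|exact: cF].
apply: (@Ck_inv _ _ _ _ (F \o cinv u)); last exact: CF.
  by apply: chart_open => //; exact: atlas_chart.
by move=> _ [y [[_ /eqP Fy] uy] <-]; rewrite /= (cinvK uA uy).
Qed.

Lemma smooth_on_sum X {mX : charted X} (S : set X) I (r : seq I) (P : pred I)
    (F : I -> X -> R) : (forall i, P i -> smooth_in X RL S (F i)) ->
  smooth_in X RL S (fun x => \sum_(i <- r | P i) F i x).
Proof.
move=> CF; elim: r => [|i r IH].
  by apply: (smooth_on_eq _ (smooth_on_const 0)) => x _; rewrite big_nil.
have [Pi|nPi] := boolP (P i).
  by apply: (smooth_on_eq _ (smooth_on_add (CF _ Pi) IH)) => x _;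
      rewrite big_cons Pi.
by apply: (smooth_on_eq _ IH) => x _; rewrite big_cons (negbTE nPi).
Qed.

Lemma smooth_on_prod X {mX : charted X} (S : set X) I (r : seq I) (P : pred I)
    (F : I -> X -> R) : (forall i, P i -> smooth_in X RL S (F i)) ->
  smooth_in X RL S (fun x => \prod_(i <- r | P i) F i x).
Proof.
move=> CF; elim: r => [|i r IH].
  by apply: (smooth_on_eq _ (smooth_on_const 1)) => x _; rewrite big_nil.
have [Pi|nPi] := boolP (P i).
  by apply: (smooth_on_eq _ (smooth_on_mul (CF _ Pi) IH)) => x _;
      rewrite big_cons Pi.
by apply: (smooth_on_eq _ IH) => x _; rewrite big_cons (negbTE nPi).
Qed.

Lemma smooth_on_opp X {mX : charted X} (S : set X) (f : X -> R) :
  smooth_in X RL S f -> smooth_in X RL S (fun x => - f x).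
Proof.
move=> Cf; apply: (smooth_on_eq _ (smooth_on_mul (smooth_on_const (-1)) Cf)) => x _.
by rewrite mulN1r.
Qed.

Lemma smooth_on_det X {mX : charted X} n (S : set X) (A : X -> 'M[R]_n) :
  (forall i j, smooth_in X RL S (fun x => A x i j)) ->
  smooth_in X RL S (fun x => \det (A x)).
Proof.
move=> CA; apply: smooth_on_sum => s _; apply: smooth_on_mul.
  exact: smooth_on_const.
by apply: smooth_on_prod => i _; exact: CA.
Qed.

(** Cramer's rule: the entries of the inverse are polynomials in the entries of
    the matrix divided by its determinant. *)
Lemma smooth_on_invmx X {mX : charted X} n (S : set X) (A : X -> 'M[R]_n) :
  (forall x, S x -> A x \in unitmx) ->
  (forall i j, smooth_in X RL S (fun x => A x i j)) ->
  forall i j, smooth_in X RL S (fun x => invmx (A x) i j).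
Proof.
move=> uA CA i j.
apply: (@smooth_on_eq X RL S (fun x => (\det (A x))^-1 * \adj (A x) i j)).
  by move=> x /uA uAx; rewrite /invmx uAx !mxE.
apply: smooth_on_mul.
  apply: smooth_on_inv; last exact: smooth_on_det.
  by move=> x /uA; rewrite unitmxE unitfE.
apply: (@smooth_on_eq X RL S (fun x => cofactor (A x) j i)).
  by move=> x _; rewrite mxE.
apply: smooth_on_mul; first exact: smooth_on_const.
apply: smooth_on_det => k l.
by apply: (smooth_on_eq _ (CA (lift j k) (lift i l))) => x _; rewrite !mxE.
Qed.

Lemma smooth_on_affR X {mX : charted X} n (S : set X) (f g : X -> 'rV[R]_n)
    (h : X -> R) :
  smooth_in X (Eu n) S f -> smooth_in X (Eu n) S g -> smooth_in X RL S h ->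
  smooth_in X (Eu n) S (fun x => affR (f x) (g x) (h x)).
Proof.
move=> Cf Cg Ch; apply: smooth_on_row => j.
apply: (@smooth_on_eq X RL S (fun x => h x * f x 0 j + (1 + - h x) * g x 0 j)).
  by move=> x _; rewrite !mxE.
apply: smooth_on_add; apply: smooth_on_mul => //; try exact: smooth_on_coord.
by apply: smooth_on_add; [exact: smooth_on_const|exact: smooth_on_opp].
Qed.

End SmoothOn.

(** * Affine bundles: translations and local coordinates *)

Section AffineCalculus.
Variable R : realType.
Local Notation RL := (real_line R).
Local Notation Eu n := (euclidean R n).

(** The point [a + l [q0,q1]]. Writing it with binary affine combinations makes
    every operation that preserves those preserve it. *)
Definition translate (E B : Defs.space R) (p : bundle E B) (a q0 q1 : E)
    (l : R) : E :=
  aff p (aff p a (aff p q1 q0 l) (2^-1)) q0 2.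

(** The point [a + sum_i l_i [q0,q_i]], one summand at a time. *)
Definition translates (E B : Defs.space R) (p : bundle E B) (I : Type) (q0 : E)
    (q : I -> E)
    (l : I -> R) (r : seq I) (a : E) : E :=
  foldl (fun a i => translate p a q0 (q i) (l i)) a r.

Definition aff_closed (E B : Defs.space R) (p : bundle E B) :=
  forall a b l, carrier E a -> carrier E b -> p a = p b ->
    carrier E (aff p a b l) /\ p (aff p a b l) = p a.

Section Closed.
Variables (E B : Defs.space R) (p : bundle E B).
Hypothesis clp : aff_closed p.

Lemma aff_proj a b l : carrier E a -> carrier E b -> p a = p b ->
  p (aff p a b l) = p a.
Proof. by move=> Ea Eb ab; have [] := clp l Ea Eb ab. Qed.

Lemma translate_closed a q0 q1 l : carrier E a -> carrier E q0 -> carrier E q1 ->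
  p q0 = p a -> p q1 = p a ->
  carrier E (translate p a q0 q1 l) /\ p (translate p a q0 q1 l) = p a.
Proof.
move=> Ea E0 E1 pq0 pq1.
have [E2 p2] := clp l E1 E0 (etrans pq1 (esym pq0)).
have [E3 p3] := clp 2^-1 Ea E2 (esym (etrans p2 pq1)).
have [E4 p4] := clp 2 E3 E0 (etrans p3 (esym pq0)).
by split=> //; rewrite p4.
Qed.

Lemma translates_closed (I : Type) q0 (q : I -> E) l r a : carrier E a ->
  carrier E q0 -> (forall i, carrier E (q i)) ->
  p q0 = p a -> (forall i, p (q i) = p a) ->
  carrier E (translates p q0 q l r a) /\ p (translates p q0 q l r a) = p a.
Proof.
move=> Ea E0 Eq pq0 pq; rewrite /translates.
elim: r a Ea pq0 pq => [|i r IH] a Ea pq0 pq //=.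
have [E1 p1] := translate_closed (l i) Ea E0 (Eq i) pq0 (pq i).
have [|j|E2 p2] := IH _ E1; first by rewrite p1.
  by rewrite p1.
by split=> //; rewrite p2.
Qed.

Variables (E' B' : Defs.space R) (p' : bundle E' B') (F : E -> E') (f : B -> B').
Hypothesis morF : affine_morphism p p' F f.

Lemma morph_aff a b l : carrier E a -> carrier E b -> p a = p b ->
  F (aff p a b l) = aff p' (F a) (F b) l.
Proof. by case: morF => _ _ _; apply. Qed.

Lemma morph_translate a q0 q1 l : carrier E a -> carrier E q0 -> carrier E q1 ->
  p q0 = p a -> p q1 = p a ->
  F (translate p a q0 q1 l) = translate p' (F a) (F q0) (F q1) l.
Proof.
move=> Ea E0 E1 pq0 pq1.
have [E2 p2] := clp l E1 E0 (etrans pq1 (esym pq0)).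
have [E3 p3] := clp 2^-1 Ea E2 (esym (etrans p2 pq1)).
rewrite /translate !morph_aff//; first by rewrite pq1.
  by rewrite p2.
by rewrite p3.
Qed.

Lemma morph_translates (I : Type) q0 (q : I -> E) l r a : carrier E a ->
  carrier E q0 -> (forall i, carrier E (q i)) ->
  p q0 = p a -> (forall i, p (q i) = p a) ->
  F (translates p q0 q l r a) = translates p' (F q0) (F \o q) l r (F a).
Proof.
move=> Ea E0 Eq pq0 pq; rewrite /translates.
elim: r a Ea pq0 pq => [|i r IH] a Ea pq0 pq //=.
have [E1 p1] := translate_closed (l i) Ea E0 (Eq i) pq0 (pq i).
rewrite IH ?p1//. 
by rewrite morph_translate.
Qed.

End Closed.

(** A local trivialisation of an affine bundle over [U], given by the fibre
    coordinate [w] and the inverse [Psi] of the trivialising diffeomorphism [a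
    |-> (p a, w a)]. *)
Record trivialization (E B : Defs.space R) (p : bundle E B) (n : nat) (U : set B)
    (w : E -> 'rV[R]_n) (Psi : B -> 'rV[R]_n -> E) : Prop := Trivialization {
  triv_open : open U;
  triv_base : U `<=` carrier B;
  triv_smooth : smooth_in E (Eu n) (carrier E `&` p @^-1` U) w;
  triv_inv_smooth : smooth_in (product B (Eu n)) E (U `*` setT)
      (fun b => Psi b.1 b.2);
  triv_carrier : forall b v, U b -> carrier E (Psi b v);
  triv_proj : forall b v, U b -> p (Psi b v) = b;
  triv_invK : forall b v, U b -> w (Psi b v) = v;
  trivK : forall a, carrier E a -> U (p a) -> Psi (p a) (w a) = a;
  triv_aff : forall a b l, carrier E a -> carrier E b -> p a = p b -> U (p b) ->
    w (aff p a b l) = affR (w a) (w b) l }.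

Section AffineBundle.
Variables (E B : Defs.space R) (p : bundle E B).
Hypothesis abp : affine_bundle p.

Lemma affine_bundle_charted_tot : charted E.
Proof. by case: abp => -[/smooth_manifold_charted]. Qed.

Lemma affine_bundle_charted_base : charted B.
Proof. by case: abp => _ [/smooth_manifold_charted]. Qed.

Let mE := affine_bundle_charted_tot.
Let mB := affine_bundle_charted_base.
#[local] Existing Instance mE.
#[local] Existing Instance mB.

Lemma affine_bundle_open_tot : open (carrier E).
Proof. by case: abp => -[_]. Qed.

Lemma affine_bundle_open_base : open (carrier B).
Proof. by case: abp => _ [_]. Qed.

Lemma affine_bundle_smooth : smooth_in E B (carrier E) p.
Proof. by case: abp => _ _ []. Qed.

Lemma affine_bundle_proj a : carrier E a -> carrier B (p a).
Proof. by case: abp => _ _ [_ H] _ _; exact: H. Qed.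

Lemma affine_bundle_closed : aff_closed p.
Proof.
move=> a b l Ea Eb ab; have [_ _ _ sp _] := abp.
have [_ [V [vec [add [Hadd _ _ affE]]]]] := sp _ (affine_bundle_proj Ea).
have Fb : fibre p (p a) b by split.
have [|Sadd _] := Hadd b (l *: vec b a); first by [].
by rewrite affE//; case: Sadd.
Qed.

Lemma preimage_open (U : set B) : open U -> open (carrier E `&` p @^-1` U).
Proof.
by move=> oU; apply: smooth_on_preimage_open affine_bundle_smooth oU;
    exact: affine_bundle_open_tot.
Qed.

Lemma triv_exists : exists n, forall b, carrier B b -> exists U w Psi,
  U b /\ @trivialization E B p n U w Psi.
Proof.
have [_ _ _ _ [n Htriv]] := abp; exists n => b Bb.
have [U [oU Ub [Phi [[Psi [[CPhi HPhi] [CPsi HPsi] PhiK PsiK]] [_ _ pP affP]]]]] :=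
  Htriv b Bb.
exists (carrier B `&` U), (fun a => (Phi a).2), (fun b v => Psi (b, v)).
split=> //.
have sub a : (carrier E `&` p @^-1` (carrier B `&` U)) a ->
    carrier (restr (p @^-1` U)) a.
  by move=> [Ea [_ Ua]].
have pP1 a : carrier E a -> U (p a) -> (Phi a).1 = p a.
  by move=> Ea Ua; exact: pP.
have PhiE a : carrier E a -> U (p a) -> Phi a = (p a, (Phi a).2).
  by move=> Ea Ua; rewrite [LHS]surjective_pairing pP1.
split=> //.
- exact: openI affine_bundle_open_base oU.
- apply: (@smooth_on_snd R E B (Eu n)); exact: (smooth_on_sub sub CPhi).
- apply: (@smooth_on_eq R (product B (Eu n)) E _ Psi); first by move=> [].
  by apply: (smooth_on_sub _ CPsi) => -[x v] [/= [Bx Ux] _].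
- by move=> x v [Bx Ux]; have [|] := HPsi (x, v).
- move=> x v [Bx Ux]; have Cv : carrier (prod_space (restr U) (whole (Eu n))) (x,
    v) by [].
  by have [Ex Ux'] := HPsi _ Cv; rewrite -pP1// PsiK.
- move=> x v [Bx Ux]; have Cv : carrier (prod_space (restr U) (whole (Eu n))) (x,
    v) by [].
  by rewrite PsiK.
- by move=> a Ea [_ Ua]; rewrite -PhiE// PhiK.
- move=> a c l Ea Ec ac [_ Uc]; rewrite affP//.
  by split=> //=; rewrite ac.
Qed.

(** In a trivialisation the combination is [affR], which is polynomial. Stating
    this for a family of points avoids fibre products as domains. *)
Lemma smooth_on_aff X {mX : charted X} (S : set X) (f g : X -> E) (h : X -> R) :
  smooth_in X E S f -> smooth_in X E S g -> smooth_in X RL S h ->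
  (forall x, S x -> carrier E (f x)) -> (forall x, S x -> carrier E (g x)) ->
  (forall x, S x -> p (f x) = p (g x)) ->
  smooth_in X E S (fun x => aff p (f x) (g x) (h x)).
Proof.
move=> Cf Cg Ch Ef Eg fg; apply: smooth_on_local => x Sx.
have [n /(_ _ (affine_bundle_proj (Eg x Sx)))[U [w [Psi [Ux T]]]]] := triv_exists.
have [W [oW Wx HW]] := smooth_on_near Cg Sx (preimage_open (triv_open T))
  (conj (Eg x Sx) Ux).
exists W; split=> //.
have gU y : (S `&` W) y -> (carrier E `&` p @^-1` U) (g y).
  by move=> [Sy Wy]; exact: HW.
have fU y : (S `&` W) y -> (carrier E `&` p @^-1` U) (f y).
  move=> SWy; have [_ Uy] := gU y SWy; have [Sy _] := SWy.
  by split; [exact: Ef|rewrite /= fg].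
apply: (@smooth_on_eq R X E _
    (fun y => Psi (p (g y)) (affR (w (f y)) (w (g y)) (h y)))).
  move=> y SWy; have [Sy Wy] := SWy.
  have [Ey Uy] := gU _ SWy; have Efy := Ef _ Sy.
  have [Ea pa] := affine_bundle_closed (h y) Efy Ey (fg y Sy).
  by rewrite -(triv_aff T) ?fg// -(fg y Sy) -{1}pa (trivK T)// pa fg.
have sub : S `&` W `<=` S by move=> y [].
apply: (@smooth_on_comp R X (product B (Eu n)) E _ _ _ _ (U `*` setT)
   (fun y => (p (g y), affR (w (f y)) (w (g y)) (h y))) (fun b => Psi b.1 b.2)).
- by move=> y /gU[].
- apply: smooth_on_pair.
    apply: (smooth_on_comp _ (smooth_on_sub sub Cg) affine_bundle_smooth).
    by move=> y [Sy _]; exact: Eg.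
  apply: smooth_on_affR; last exact: smooth_on_sub sub Ch.
    exact: smooth_on_comp fU (smooth_on_sub sub Cf) (triv_smooth T).
  exact: smooth_on_comp gU (smooth_on_sub sub Cg) (triv_smooth T).
- exact: triv_inv_smooth T.
Qed.

Lemma smooth_on_translate X {mX : charted X} (S : set X) (f q0 q1 : X -> E)
    (h : X -> R) :
  smooth_in X E S f -> smooth_in X E S q0 -> smooth_in X E S q1 ->
      smooth_in X RL S h ->
  (forall x, S x -> [/\ carrier E (f x), carrier E (q0 x) & carrier E (q1 x)]) ->
  (forall x, S x -> p (q0 x) = p (f x)) -> (forall x, S x -> p (q1 x) = p (f x)) ->
  smooth_in X E S (fun x => translate p (f x) (q0 x) (q1 x) (h x)).
Proof.
move=> Cf C0 C1 Ch EE p0 p1.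
have H1 x : S x -> carrier E (aff p (q1 x) (q0 x) (h x)) /\
    p (aff p (q1 x) (q0 x) (h x)) = p (f x).
  move=> Sx; have [Ef E0 E1] := EE _ Sx; rewrite -(p1 _ Sx).
  by apply: affine_bundle_closed; rewrite // p0 ?p1.
have H2 x : S x -> carrier E (aff p (f x) (aff p (q1 x) (q0 x) (h x)) 2^-1) /\
    p (aff p (f x) (aff p (q1 x) (q0 x) (h x)) 2^-1) = p (f x).
  move=> Sx; have [Ef E0 E1] := EE _ Sx; have [Ea pa] := H1 _ Sx.
  by apply: affine_bundle_closed.
apply: smooth_on_aff => //; first apply: smooth_on_aff => //;
    first apply: smooth_on_aff => //.
- by move=> x /EE[].
- by move=> x /EE[].
- by move=> x Sx; rewrite p0 ?p1.
- exact: smooth_on_const.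
- by move=> x /EE[].
- by move=> x /H1[].
- by move=> x /H1[].
- exact: smooth_on_const.
- by move=> x /H2[].
- by move=> x /EE[].
- by move=> x Sx; have [_ ->] := H2 _ Sx; rewrite p0.
Qed.

Lemma smooth_on_translates X {mX : charted X} (S : set X) (I : Type) (r : seq I)
    (f q0 : X -> E)
    (q : I -> X -> E) (h : I -> X -> R) :
  smooth_in X E S f -> smooth_in X E S q0 -> (forall i, smooth_in X E S (q i)) ->
  (forall i, smooth_in X RL S (h i)) ->
  (forall x, S x -> carrier E (f x)) -> (forall x, S x -> carrier E (q0 x)) ->
  (forall i x, S x -> carrier E (q i x)) ->
  (forall x, S x -> p (q0 x) = p (f x)) ->
  (forall i x, S x -> p (q i x) = p (f x)) ->
  smooth_in X E S (fun x => translates p (q0 x) (q^~ x) (h^~ x) r (f x)).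
Proof.
move=> + C0 Cq Ch + E0 Eq; rewrite /translates.
elim: r f => [|i r IH] f Cf Ef p0 pq //=.
have H x : S x -> carrier E (translate p (f x) (q0 x) (q i x) (h i x)) /\
    p (translate p (f x) (q0 x) (q i x) (h i x)) = p (f x).
  move=> Sx; apply: (translate_closed affine_bundle_closed);
    [exact: Ef|exact: E0|exact: Eq|exact: p0|exact: pq].
apply: (IH (fun x => translate p (f x) (q0 x) (q i x) (h i x))).
- apply: smooth_on_translate => //; [|exact: pq].
  by move=> x Sx; split; [exact: Ef|exact: E0|exact: Eq].
- by move=> x /H[].
- by move=> x Sx; have [_ ->] := H _ Sx; exact: p0.
- by move=> j x Sx; have [_ ->] := H _ Sx; exact: pq.
Qed.

Section Coordinate.
Variables (n : nat) (U : set B) (w : E -> 'rV[R]_n) (Psi : B -> 'rV[R]_n -> E).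
Hypothesis T : trivialization p U w Psi.

Lemma triv_inj a b : carrier E a -> carrier E b -> p a = p b -> U (p b) ->
  w a = w b -> a = b.
Proof.
move=> Ea Eb ab Ub wab.
by rewrite -(trivK T Ea) ?ab// wab (trivK T Eb).
Qed.

Lemma triv_translate a q0 q1 l : carrier E a -> carrier E q0 -> carrier E q1 ->
  p q0 = p a -> p q1 = p a -> U (p a) ->
  w (translate p a q0 q1 l) = w a + l *: (w q1 - w q0).
Proof.
move=> Ea E0 E1 pq0 pq1 Ua.
have clp := affine_bundle_closed.
have [E2 p2] := clp _ _ l E1 E0 (etrans pq1 (esym pq0)).
have [E3 p3] := clp _ _ 2^-1 Ea E2 (esym (etrans p2 pq1)).
rewrite /translate !(triv_aff T)//; last first.
- by rewrite pq0.
- by rewrite p3.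
- by rewrite p2 pq1.
- by rewrite p2.
- by rewrite pq0.
- by rewrite pq1.
by apply/rowP => j; rewrite !mxE; field.
Qed.

Lemma triv_translates (I : Type) q0 (q : I -> E) l r a : carrier E a ->
  carrier E q0 -> (forall i, carrier E (q i)) ->
  p q0 = p a -> (forall i, p (q i) = p a) -> U (p a) ->
  w (translates p q0 q l r a) = w a + \sum_(i <- r) l i *: (w (q i) - w q0).
Proof.
move=> Ea E0 Eq pq0 pq Ua; rewrite /translates.
elim: r a Ea pq0 pq Ua => [|i r IH] a Ea pq0 pq Ua.
  by rewrite big_nil addr0.
have [E1 p1] := translate_closed affine_bundle_closed (l i) Ea E0 (Eq i) pq0 (pq i).
rewrite /= IH ?p1//.
by rewrite triv_translate// big_cons addrA.
Qed.

End Coordinate.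
End AffineBundle.
End AffineCalculus.

(** * The two affine structures of a double affine bundle *)

Section AffineIdentities.
Variable R : realType.
Local Notation RL := (real_line R).
Local Notation Eu n := (euclidean R n).

(** Midpoints give linearity over the rationals, by additivity; continuity
    extends it to all reals. *)
Lemma midpoint_affine (f : R -> R) : continuous f ->
  (forall x y, f ((x + y) / 2) = (f x + f y) / 2) ->
  forall x, f x = x * f 1 + (1 - x) * f 0.
Proof.
move=> cf fm; pose h x := f x - (x * f 1 + (1 - x) * f 0).
suff h0 x : h x = 0 by move=> x; apply/eqP; rewrite -subr_eq0; exact/eqP/h0.
have hm a b : h ((a + b) / 2) = (h a + h b) / 2 by rewrite /h fm; field.
have h00 : h 0 = 0 by rewrite /h; ring.
have h1 : h 1 = 0 by rewrite /h; ring.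
have hD a b : h (a + b) = h a + h b.
  have E c : h c = (h (2 * c) + h 0) / 2 by rewrite -hm; congr h; field.
  rewrite -[in LHS](mulr1 (a + b)) (_ : (a + b) * 1 = (2 * a + 2 * b) / 2);
      last by field.
  by rewrite hm [in RHS](E a) [in RHS](E b) h00; field.
have hn (n : nat) a : h (n%:R * a) = n%:R * h a.
  elim: n => [|n IH]; first by rewrite !mul0r.
  by rewrite -natr1 !mulrDl !mul1r hD IH.
have hN a : h (- a) = - h a.
  by apply/eqP; rewrite eq_sym -subr_eq0 -opprD oppr_eq0 -hD subrr h00.
have hz (z : int) a : h (z%:~R * a) = z%:~R * h a.
  case: z => n; first exact: hn.
  by rewrite NegzE mulrNz mulNr hN -[n.+1%:~R]/(n.+1%:R) hn mulNr.
have hq (q : rat) : h (ratr q) = 0.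
  have dq : (denq q)%:~R != 0 :> R by rewrite intr_eq0 denq_neq0.
  have : (denq q)%:~R * h (ratr q) = 0.
    rewrite -hz /ratr mulrC divfK// -[X in h X]mulr1 hz h1 mulr0 //.
  by move/eqP; rewrite mulf_eq0 (negbTE dq) => /eqP.
have ch : continuous h.
  move=> y; rewrite /h; apply: cvgB; first exact: cf.
  apply: cvgD; apply: cvgM; try exact: cvg_cst; first exact: cvg_id.
  by apply: cvgB; [exact: cvg_cst|exact: cvg_id].
apply/eqP; apply: contrapT => /negP hx0.
have oN : open (h @^-1` [set y | y != 0]).
  by apply: open_comp => [y _|]; [exact: ch|exact: open_neq].
have [y [/= hy [q _ qy]]] := dense_rat (ex_intro _ x hx0) oN.
by rewrite -qy hq eqxx in hy.
Qed.

Section OneBundle.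
Variables (E B : Defs.space R) (p : bundle E B).
Hypothesis abp : affine_bundle p.

(** Identities between affine combinations in a fibre are checked in
    coordinates. *)
Lemma fibre_ext a b : carrier E a -> carrier E b -> p a = p b ->
  (forall n U w Psi, @trivialization R E B p n U w Psi -> U (p b) ->
      w a = w b) -> a = b.
Proof.
move=> Ea Eb ab H.
have [n /(_ _ (affine_bundle_proj abp Eb))[U [w [Psi [Ub T]]]]] := triv_exists abp.
by apply: (triv_inj T) => //; exact: H T Ub.
Qed.

Lemma aff_id a l : carrier E a -> aff p a a l = a.
Proof.
move=> Ea; have [E1 p1] := affine_bundle_closed abp l Ea Ea erefl.
apply: fibre_ext => // n U w Psi T Ua; rewrite (triv_aff T)//.
by apply/rowP => j; rewrite !mxE; ring.
Qed.

Lemma aff_at1 a b : carrier E a -> carrier E b -> p a = p b -> aff p a b 1 = a.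
Proof.
move=> Ea Eb ab; have [E1 p1] := affine_bundle_closed abp 1 Ea Eb ab.
apply: fibre_ext => // n U w Psi T Ua; rewrite (triv_aff T) -?ab//.
by apply/rowP => j; rewrite !mxE; ring.
Qed.

Lemma aff_at0 a b : carrier E a -> carrier E b -> p a = p b -> aff p a b 0 = b.
Proof.
move=> Ea Eb ab; have [E1 p1] := affine_bundle_closed abp 0 Ea Eb ab.
apply: fibre_ext => // [|n U w Psi T Ua]; first by rewrite p1.
rewrite (triv_aff T)//.
by apply/rowP => j; rewrite !mxE; ring.
Qed.

Lemma aff_midC a b : carrier E a -> carrier E b -> p a = p b ->
  aff p a b 2^-1 = aff p b a 2^-1.
Proof.
move=> Ea Eb ab; have [E1 p1] := affine_bundle_closed abp 2^-1 Ea Eb ab.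
have [E2 p2] := affine_bundle_closed abp 2^-1 Eb Ea (esym ab).
apply: fibre_ext => // [|n U w Psi T Ua]; first by rewrite p1 p2.
rewrite p2 in Ua; rewrite !(triv_aff T) ?ab//.
by apply/rowP => j; rewrite !mxE; field.
Qed.

Lemma aff_mid a b l m : carrier E a -> carrier E b -> p a = p b ->
  aff p a b ((l + m) / 2) = aff p (aff p a b l) (aff p a b m) 2^-1.
Proof.
move=> Ea Eb ab; have clp := affine_bundle_closed abp.
have [E0 p0] := clp _ _ ((l + m) / 2) Ea Eb ab.
have [E1 p1] := clp _ _ l Ea Eb ab.
have [E2 p2] := clp _ _ m Ea Eb ab.
have [E3 p3] := clp _ _ 2^-1 E1 E2 (etrans p1 (esym p2)).
apply: fibre_ext => // [|n U w Psi T Ua]; first by rewrite p0 p3.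
rewrite p3 p1 ab in Ua; rewrite !(triv_aff T) ?p1 ?p2 ?ab//.
by apply/rowP => j; rewrite !mxE; field.
Qed.

End OneBundle.

Section Double.
Variables (E A1 A2 M : Defs.space R) (p1 : bundle E A1) (p2 : bundle E A2)
  (q2 : bundle A2 M) (q1 : bundle A1 M).
Hypothesis dD : double_affine_bundle (DBundle p1 p2 q2 q1).

Lemma affine_pi1 : affine_bundle p1. Proof. by case: dD => -[]. Qed.
Lemma affine_pi2 : affine_bundle p2. Proof. by case: dD => -[]. Qed.
Lemma affine_q2 : affine_bundle q2. Proof. by case: dD => -[]. Qed.
Lemma affine_q1 : affine_bundle q1. Proof. by case: dD => -[]. Qed.

Lemma base_eq a : carrier E a -> q1 (p1 a) = q2 (p2 a).
Proof. by case: dD => -[_ _ _ _ H] _ _ _; exact: H. Qed.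

Lemma pi1_morphism : affine_morphism p2 q1 p1 q2.
Proof. by case: dD => _ []. Qed.

Lemma pi2_morphism : affine_morphism p1 q2 p2 q1.
Proof. by case: dD => _ []. Qed.

Lemma double_surj a1 a2 : carrier A1 a1 -> carrier A2 a2 -> q1 a1 = q2 a2 ->
  exists a, [/\ carrier E a, p1 a = a1 & p2 a = a2].
Proof. by case: dD => _ _ H _; exact: H. Qed.

Lemma square_morphism l : exists f, affine_morphism (square_bundle p1 p2 q2) p2
  (fun a => aff p1 a.1 a.2 l) f.
Proof. by case: dD => _ _ _ /(_ l)[]. Qed.

Let cl1 := affine_bundle_closed affine_pi1.
Let cl2 := affine_bundle_closed affine_pi2.

(** A fibre of the square bundle is closed under affine combinations because
    [p1] is affine for the structure of [p2]. *)
Lemma square_closed : aff_closed (square_bundle p1 p2 q2).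
Proof.
move=> [a a'] [b b'] l [[/= Ea Ea'] aa'] [[/= Eb Eb'] bb'] [ab ab'].
have [E1 pE1] := cl2 l Ea Eb ab; have [E2 pE2] := cl2 l Ea' Eb' ab'.
split; last by congr (_, _).
split=> //=; rewrite (morph_aff pi1_morphism)// (morph_aff pi1_morphism)//.
by rewrite aa' bb'.
Qed.

Lemma interchange a b a' b' l m :
  carrier E a -> carrier E b -> carrier E a' -> carrier E b' ->
  p2 a = p2 b -> p2 a' = p2 b' -> p1 a = p1 a' -> p1 b = p1 b' ->
  aff p1 (aff p2 a b m) (aff p2 a' b' m) l =
  aff p2 (aff p1 a a' l) (aff p1 b b' l) m.
Proof.
move=> Ea Eb Ea' Eb' ab ab' aa' bb'; have [f [_ _ _ H]] := square_morphism l.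
by have := H (a, a') (b, b') m; apply; rewrite //= ?ab ?ab'.
Qed.

Lemma interchange_translates (I : Type) (r : seq I) (l : I ->
    R) a q0 q a' q0' q' t :
  carrier E a -> carrier E q0 -> (forall i : I, carrier E (q i)) ->
  carrier E a' -> carrier E q0' -> (forall i : I, carrier E (q' i)) ->
  p2 q0 = p2 a -> (forall i, p2 (q i) = p2 a) ->
  p2 q0' = p2 a' -> (forall i, p2 (q' i) = p2 a') ->
  p1 a = p1 a' -> p1 q0 = p1 q0' -> (forall i, p1 (q i) = p1 (q' i)) ->
  aff p1 (translates p2 q0 q l r a) (translates p2 q0' q' l r a') t =
  translates p2 (aff p1 q0 q0' t) (fun i => aff p1 (q i) (q' i) t) l r
      (aff p1 a a' t).
Proof.
move=> Ea E0 Eq Ea' E0' Eq' e0 eq e0' eq' aa' q00 qq.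
have [f morf] := square_morphism t.
have := @morph_translates _ _ _ _ square_closed _ _ _ _ _ morf I (q0, q0')
  (fun i => (q i, q' i)) l r (a, a').
move=> /(_ (conj (conj Ea Ea') aa') (conj (conj E0 E0') q00)).
have -> : translates (square_bundle p1 p2 q2) (q0, q0') (fun i => (q i,
    q' i)) l r (a, a')
  = (translates p2 q0 q l r a, translates p2 q0' q' l r a').
  by rewrite /translates; elim: r (a) (a') => [//|i r IH b b' /=]; rewrite -IH.
by apply=> [i||i] /=; rewrite ?e0 ?e0' ?eq ?eq'.
Qed.

(** An Eckmann-Hilton argument. On a common fibre of [p1] and [p2],
    interchanging the midpoint of [a, b] with the midpoint of [b, a] shows that
    the two structures have the same midpoints. A line for [p2] is therefore
    midpoint-affine for [p1], and it is continuous, so it is a line for [p1]. *)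
Lemma aff_agree a b l : carrier E a -> carrier E b -> p1 a = p1 b ->
  p2 a = p2 b -> aff p1 a b l = aff p2 a b l.
Proof.
move=> Ea Eb e1 e2.
have mid c d : carrier E c -> carrier E d -> p1 c = p1 d -> p2 c = p2 d ->
    aff p1 c d 2^-1 = aff p2 c d 2^-1.
  move=> Ec Ed cd1 cd2.
  have [E1 pE1] := cl1 2^-1 Ec Ed cd1; have [E2 pE2] := cl2 2^-1 Ec Ed cd2.
  have := @interchange c d d c 2^-1 2^-1 Ec Ed Ed Ec cd2 (esym cd2) cd1 (esym cd1).
  by rewrite (aff_midC affine_pi2 Ed Ec (esym cd2)) (aff_midC affine_pi1 Ed Ec
      (esym cd1))
    (aff_id affine_pi1)// (aff_id affine_pi2).
have in2 m : [/\ carrier E (aff p2 a b m), p1 (aff p2 a b m) = p1 a &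
    p2 (aff p2 a b m) = p2 a].
  have [E2 pE2] := cl2 m Ea Eb e2; split=> //.
  by rewrite (morph_aff pi1_morphism)// e1 (aff_id affine_q1)//;
      exact: (affine_bundle_proj affine_pi1).
have [n /(_ _ (affine_bundle_proj affine_pi1 Eb))[U [w [Psi [Ub T]]]]] :=
    triv_exists affine_pi1.
have Ua : U (p1 a) by rewrite e1.
have mE := affine_bundle_charted_tot affine_pi1.
have Cg : smooth_in RL (Eu n) setT (fun m : R => w (aff p2 a b m)).
  apply: (smooth_on_comp (T := carrier E `&` p1 @^-1` U) _ _ (triv_smooth T)).
    by move=> m _; have [E2 pE1 _] := in2 m; split=> //=; rewrite pE1.
  apply: (smooth_on_aff affine_pi2 (f := fun=> a) (g := fun=> b)) => //;
      try exact: smooth_on_cst.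
  exact: smooth_on_id.
have [E1 pE1] := cl1 l Ea Eb e1; have [E2 pE2 _] := in2 l.
apply: (triv_inj T) => //; rewrite ?pE1 ?pE2 //.
rewrite (triv_aff T)//; apply/rowP => j.
have := @midpoint_affine (fun m => w (aff p2 a b m) 0 j).
move=> -> //.
- by rewrite (aff_at1 affine_pi2)// (aff_at0 affine_pi2)// !mxE.
- move=> m; apply: (smooth_on_continuous openT (smooth_on_coord j Cg)) => //.
- move=> x y; have [Ex px1 px2] := in2 x; have [Ey py1 py2] := in2 y.
  rewrite (aff_mid affine_pi2)// -mid// ?px1 ?py1 ?px2 ?py2//.
  by rewrite (triv_aff T)// ?py1 ?px1// !mxE; field.
Qed.

End Double.
End AffineIdentities.

(** * Coordinates along a section of the first side bundle *)

Section Linear.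
Variable R : realType.

(** The origin being fixed, [2 *: affR v v' 2^-1] recovers addition. *)
Lemma affR_linear N m (F : 'rV[R]_N -> 'rV[R]_m) :
  (forall v v' l, F (affR v v' l) = affR (F v) (F v') l) ->
  forall v, F v = F 0 + v *m \matrix_(k < N) (F 'e_k - F 0).
Proof.
move=> HF; pose G v := F v - F 0.
have GZ l v : G (l *: v) = l *: G v.
  rewrite /G (_ : l *: v = affR v 0 l); last by rewrite /affR scaler0 addr0.
  by rewrite HF; apply/rowP => j; rewrite !mxE; ring.
have GD v v' : G (v + v') = G v + G v'.
  have -> : v + v' = 2 *: affR v v' 2^-1.
    by apply/rowP => j; rewrite !mxE; field.
  by rewrite GZ /G HF; apply/rowP => j; rewrite !mxE; field.
have G0 : G 0 = 0 by rewrite /G subrr.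
move=> v; apply/eqP; rewrite addrC -subr_eq -/(G v); apply/eqP.
rewrite [in LHS](row_sum_delta v) mulmx_sum_row (big_morph G GD G0).
by apply: eq_bigr => k _; rewrite GZ rowK.
Qed.

(** Gaussian elimination brings [L] to the first [n2] columns of the identity,
    which the remaining columns complete. *)
Lemma complement_mx n2 n (L : 'M[R]_(n2 + n, n2)) : row_full L ->
  exists T : 'M[R]_(n2 + n, n), row_mx L T \in unitmx.
Proof.
move=> /eqP rL.
exists (col_ebase L *m col_mx 0 1%:M).
have -> : row_mx L (col_ebase L *m col_mx 0 1%:M) =
    col_ebase L *m block_mx (row_ebase L) 0 0 1%:M.
  rewrite -{1}(mulmx_ebase L) rL block_mxEh mul_mx_row -!mulmxA;
      congr (row_mx (_ *m _) _).
  by rewrite pid_mx_col mul_col_mx mul1mx mul0mx.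
rewrite unitmx_mul col_ebase_unit /= unitmxE det_ublock det1 mulr1 -unitmxE.
exact: row_ebase_unit.
Qed.

End Linear.

Section SectionLemma.
Variable R : realType.
Local Notation RL := (real_line R).
Local Notation Eu n := (euclidean R n).
Variables (E A1 A2 M : Defs.space R) (p1 : bundle E A1) (p2 : bundle E A2)
  (q2 : bundle A2 M) (q1 : bundle A1 M).
Hypothesis dD : double_affine_bundle (DBundle p1 p2 q2 q1).

Let mE := affine_bundle_charted_tot (affine_pi1 dD).
Let mA1 := affine_bundle_charted_base (affine_pi1 dD).
Let mA2 := affine_bundle_charted_base (affine_pi2 dD).
Let mM := affine_bundle_charted_base (affine_q1 dD).
#[local] Existing Instance mE.
#[local] Existing Instance mA1.
#[local] Existing Instance mA2.
#[local] Existing Instance mM.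

Variables (n2 : nat) (U2 : set M) (w2 : A2 -> 'rV[R]_n2) (Psi2 : M ->
    'rV[R]_n2 -> A2).
Hypothesis T2 : trivialization q2 U2 w2 Psi2.

Section FibreMatrix.
Variables (N : nat) (O : set A1) (w : E -> 'rV[R]_N) (Xi : A1 -> 'rV[R]_N -> E).
Hypothesis T : trivialization p1 O w Xi.

(** The coordinate [z] of a point of a fibre of [p1], as a function of its
    coordinate in a trivialisation of [p1]. *)
Definition fibre_map (a1 : A1) (v : 'rV[R]_N) := w2 (p2 (Xi a1 v)).
Definition fibre_mx (a1 : A1) : 'M[R]_(N, n2) :=
  \matrix_(k < N) (fibre_map a1 'e_k - fibre_map a1 0).

Lemma triv_inv_aff a1 v v' l : O a1 ->
  Xi a1 (affR v v' l) = aff p1 (Xi a1 v) (Xi a1 v') l.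
Proof.
move=> Oa; have Ev u := triv_carrier T u Oa; have pv u := triv_proj T u Oa.
have e u u' : p1 (Xi a1 u) = p1 (Xi a1 u') by rewrite !pv.
have [E1 pE1] := affine_bundle_closed (affine_pi1 dD) l (Ev v) (Ev v') (e _ _).
apply: (triv_inj T) => //; rewrite ?pE1 ?pv//.
by rewrite (triv_aff T) ?(triv_invK T) ?pv.
Qed.

Lemma fibre_proj a1 v : O a1 -> q2 (p2 (Xi a1 v)) = q1 a1.
Proof.
move=> Oa; rewrite -(base_eq dD) ?(triv_proj T)//; exact: (triv_carrier T).
Qed.

Lemma pi2_carrier a : carrier E a -> carrier A2 (p2 a).
Proof. exact: (affine_bundle_proj (affine_pi2 dD)). Qed.

Lemma fibre_mapE a1 v : O a1 -> U2 (q1 a1) ->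
  fibre_map a1 v = fibre_map a1 0 + v *m fibre_mx a1.
Proof.
move=> Oa Ua; apply: affR_linear => {}v v' l; rewrite /fibre_map triv_inv_aff//.
have Ev u := triv_carrier T u Oa; have pv u := triv_proj T u Oa.
rewrite (morph_aff (pi2_morphism dD))// ?pv// (triv_aff T2) ?fibre_proj//.
  exact: pi2_carrier.
exact: pi2_carrier.
Qed.

(** This is where the surjectivity of [E -> A1 x_M A2] enters. *)
Lemma fibre_mx_full a1 : O a1 -> U2 (q1 a1) -> row_full (fibre_mx a1).
Proof.
move=> Oa Ua; rewrite -sub1mx; apply/row_subP => i.
pose z := fibre_map a1 0 + row i 1%:M.
have [a [Ea pa pa2]] : exists a, [/\ carrier E a, p1 a = a1 & p2 a = Psi2
    (q1 a1) z].
  apply: (double_surj dD); first exact: (triv_base T).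
    exact: (triv_carrier T2).
  by rewrite (triv_proj T2).
have Ow : O (p1 a) by rewrite pa.
have Xa : Xi a1 (w a) = a by rewrite -pa (trivK T).
have := fibre_mapE (w a) Oa Ua; rewrite {1}/fibre_map Xa pa2 (triv_invK T2)//.
by move=> /addrI ->; exact: submxMl.
Qed.

End FibreMatrix.

Lemma fibre_rank N O w Xi a1 : @trivialization R E A1 p1 N O w Xi -> O a1 -> U2
    (q1 a1) ->
  (n2 <= N)%N.
Proof.
move=> T Oa Ua; have /eqP <- := fibre_mx_full T Oa Ua; exact: rank_leq_row.
Qed.

(** Over the image of a section [y] of [q1], the fibres of [p1] carry the
    coordinates [(w2 \o p2, kappa)] with inverse [tau x]; the first component is
    the coordinate [z] of the base point in [A2], the second one will be the
    coordinate [c]. *)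
Record slice n (y : M -> A1) (U : set M) (tau : M -> 'rV[R]_n2 -> 'rV[R]_n -> E)
    (kappa : E -> 'rV[R]_n) : Prop := Slice {
  slice_open : open U;
  slice_base : U `<=` U2;
  slice_smooth : smooth_in (product (product M (Eu n2)) (Eu n)) E
    (U `*` setT `*` setT) (fun b => tau b.1.1 b.1.2 b.2);
  slice_coord_smooth : smooth_in E (Eu n)
    [set a | [/\ carrier E a, U (q1 (p1 a)) & p1 a = y (q1 (p1 a))]] kappa;
  slice_carrier : forall x z c, U x -> carrier E (tau x z c);
  slice_proj1 : forall x z c, U x -> p1 (tau x z c) = y x;
  slice_proj2 : forall x z c, U x -> p2 (tau x z c) = Psi2 x z;
  slice_coordK : forall x z c, U x -> kappa (tau x z c) = c;
  sliceK : forall a, carrier E a -> U (q1 (p1 a)) -> p1 a = y (q1 (p1 a)) ->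
    tau (q1 (p1 a)) (w2 (p2 a)) (kappa a) = a;
  slice_coord_aff : forall a b l, carrier E a -> carrier E b -> p1 a = p1 b ->
    U (q1 (p1 a)) -> p1 a = y (q1 (p1 a)) ->
    kappa (aff p1 a b l) = affR (kappa a) (kappa b) l }.

(** [tau x] inverts an affine coordinate system, hence is affine. *)
Lemma slice_aff n y U tau kappa x z z' c c' l : @slice n y U tau kappa -> U x ->
  (forall x, U x -> q1 (y x) = x) ->
  tau x (affR z z' l) (affR c c' l) = aff p1 (tau x z c) (tau x z' c') l.
Proof.
move=> S Ux qy; have E0 := slice_carrier S z c Ux;
    have E1 := slice_carrier S z' c' Ux.
have pE0 := slice_proj1 S z c Ux; have pE1 := slice_proj1 S z' c' Ux.
have e : p1 (tau x z c) = p1 (tau x z' c') by rewrite pE0 pE1.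
have [E2 pE2] := affine_bundle_closed (affine_pi1 dD) l E0 E1 e.
have e2 : q1 (p1 (aff p1 (tau x z c) (tau x z' c') l)) = x by rewrite pE2 pE0 qy.
rewrite -[RHS](sliceK S)//; last 2 first.
- by rewrite e2.
- by rewrite e2 pE2 pE0.
have Ux2 := slice_base S Ux.
rewrite e2; congr (tau _ _ _).
  rewrite (morph_aff (pi2_morphism dD))// (triv_aff T2); first last.
  - by rewrite (slice_proj2 S) // (triv_proj T2).
  - by rewrite !(slice_proj2 S) // !(triv_proj T2).
  - exact: pi2_carrier.
  - exact: pi2_carrier.
  by rewrite !(slice_proj2 S) // !(triv_invK T2).
rewrite (slice_coord_aff S)// ?(slice_coordK S)//; rewrite pE0 qy//.
Qed.

(** In a trivialisation of [p1] near [y x0] with coordinate [w], the coordinate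
    [z] is [b x + w *m L x] with [L x] of full rank. A constant matrix [Tm] that
    makes [row_mx (L x) Tm] invertible at [x0] does so near [x0], and there [(z,
    w *m Tm)] is a coordinate system. *)
Lemma slice_exists n (O : set A1) w Xi (U0 : set M) (y : M -> A1) x0 :
  @trivialization R E A1 p1 (n2 + n) O w Xi ->
  open U0 -> U0 x0 -> U2 x0 -> O (y x0) -> smooth_in M A1 U0 y ->
  (forall x, U0 x -> q1 (y x) = x) ->
  exists U tau kappa, [/\ U x0, U `<=` U0 & @slice n y U tau kappa].
Proof.
move=> T oU0 U0x U2x Oy Cy qy.
have [Tm uT] : exists Tm, row_mx (fibre_mx Xi (y x0)) Tm \in unitmx.
  by apply/complement_mx/(fibre_mx_full T) => //; rewrite qy.
pose G x := row_mx (fibre_mx Xi (y x)) Tm.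
pose V := (U0 `&` y @^-1` O) `&` U2.
have oV : open V.
  by apply: openI; [exact: smooth_on_preimage_open oU0 Cy
      (triv_open T)|exact: triv_open T2].
have VO x : V x -> O (y x) by case=> -[].
have VU2 x : V x -> U2 (q1 (y x)) by case=> -[U0x' _] ?; rewrite qy.
have VU0 x : V x -> U0 x by case=> -[].
have CyV : smooth_in M A1 V y by apply: smooth_on_sub Cy.
have Cmap v j : smooth_in M RL V (fun x => fibre_map Xi (y x) v 0 j).
  apply: smooth_on_coord; apply: (smooth_on_comp (T :=
      carrier A2 `&` q2 @^-1` U2) _ _ (triv_smooth T2)).
    move=> x Vx; split; first by apply/pi2_carrier/(triv_carrier T)/VO.
    by rewrite /= (fibre_proj T); [exact: VU2|exact: VO].
  apply: (smooth_on_comp (T := carrier E) _ _ (affine_bundle_smooth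
      (affine_pi2 dD))).
    by move=> x Vx; apply/(triv_carrier T)/VO.
  apply: (@smooth_on_comp R M (product A1 (Eu (n2 + n))) E _ _ _ V (O `*` setT)
    (fun x => (y x, v)) (fun b => Xi b.1 b.2)).
  - by move=> x Vx; split=> //; exact: VO.
  - by apply: smooth_on_pair => //; exact: (@smooth_on_cst R M (Eu (n2 + n))).
  - exact: triv_inv_smooth T.
have CG i j : smooth_in M RL V (fun x => G x i j).
  case: (split_ordP j) => k ->.
    apply: (@smooth_on_eq R M RL V
      (fun x => fibre_map Xi (y x) 'e_i 0 k + - fibre_map Xi (y x) 0 0 k)).
      by move=> x _; rewrite row_mxEl !mxE.
    by apply: smooth_on_add; [exact: Cmap|apply: smooth_on_opp; exact: Cmap].
  apply: (@smooth_on_eq R M RL V (fun x => Tm i k)); last exact: smooth_on_const.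
  by move=> x _; rewrite row_mxEr.
pose U := V `&` (fun x => \det (G x)) @^-1` [set r | r != 0].
have oU : open U by apply: smooth_on_preimage_open oV (smooth_on_det CG) _;
    exact: open_neq.
have UV x : U x -> V x by case.
have UG x : U x -> G x \in unitmx by move=> [_ dG]; rewrite unitmxE unitfE.
pose kappa a := w a *m Tm.
pose b x := fibre_map Xi (y x) 0.
pose tau x (z : 'rV[R]_n2) (c : 'rV[R]_n) := Xi (y x) (row_mx
    (z - b x) c *m invmx (G x)).
have E_tau x z c : U x -> carrier E (tau x z c).
  by move=> Ux; apply/(triv_carrier T)/VO/UV.
have p1_tau x z c : U x -> p1 (tau x z c) = y x.
  by move=> Ux; apply/(triv_proj T)/VO/UV.
have q1y x : U x -> q1 (y x) = x by move=> /UV/VU0/qy.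
have w_tau x z c : U x -> w (tau x z c) *m G x = row_mx (z - b x) c.
  move=> Ux; rewrite (triv_invK T) ?mulmxKV//; last exact: VO (UV _ Ux).
  exact: UG.
have wG x a : U x -> carrier E a -> p1 a = y x ->
    w a *m G x = row_mx (w2 (p2 a) - b x) (kappa a).
  move=> Ux Ea pa; rewrite mul_mx_row; congr row_mx.
  have Oy' := VO _ (UV _ Ux); have Uy := VU2 _ (UV _ Ux).
  have := fibre_mapE T (w a) Oy' Uy.
  rewrite {1}/fibre_map -{1}pa (trivK T) ?pa// => ->.
  by rewrite addrC addKr.
have wp2_tau x z c : U x -> w2 (p2 (tau x z c)) = z /\ kappa (tau x z c) = c.
  move=> Ux; have := wG x _ Ux (E_tau x z c Ux) (p1_tau x z c Ux).
  by rewrite w_tau// => /eq_row_mx[/addIr ez ec]; split.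
exists U, tau, kappa; split.
- split; first exact: (conj (conj U0x Oy) U2x).
  by move: uT; rewrite unitmxE unitfE.
- by move=> x /UV/VU0.
split=> //.
- by move=> x [[_ ?]].
- apply: (@smooth_on_comp R (product (product M (Eu n2)) (Eu n)) (product A1 (Eu
    (n2 + n))) E
    _ _ _ _ (O `*` setT)
    (fun t => (y t.1.1, row_mx (t.1.2 - b t.1.1) t.2 *m invmx (G t.1.1)))
    (fun b => Xi b.1 b.2)).
  + by move=> [[x z] c] [[/= Ux _] _]; split=> //; exact/VO/UV.
  + have C1 : smooth_in (product (product M (Eu n2)) (Eu n)) M
      (U `*` setT `*` setT) (fun t => t.1.1).
      by do 2 apply: smooth_on_fst; exact: smooth_on_id.
    have CzC : smooth_in (product (product M (Eu n2)) (Eu n)) (Eu n2)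
        (U `*` setT `*` setT) (fun t => t.1.2).
      by apply: smooth_on_snd; apply: smooth_on_fst; exact: smooth_on_id.
    have CcC : smooth_in (product (product M (Eu n2)) (Eu n)) (Eu n)
        (U `*` setT `*` setT) (fun t => t.2).
      by apply: smooth_on_snd; exact: smooth_on_id.
    have in1 (t : product (product M (Eu n2)) (Eu n)) :
       (U `*` setT `*` setT) t -> U t.1.1 by move=> [[]].
    apply: smooth_on_pair.
      exact: (smooth_on_comp (fun t Ut => UV _ (in1 t Ut)) C1 CyV).
    apply: smooth_on_row => j.
    apply: (@smooth_on_eq R _ RL _ (fun t : product (product M (Eu n2)) (Eu n) =>
      \sum_k row_mx (t.1.2 - b t.1.1) t.2 0 k * invmx (G t.1.1) k j)).
      by move=> t _; rewrite mxE.
    apply: smooth_on_sum => k _; apply: smooth_on_mul; last first.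
      apply: (@smooth_on_comp R (product (product M (Eu n2))
          (Eu n)) M RL _ _ _ _ U (fun t => t.1.1) (fun x => invmx
          (G x) k j) in1 C1).
      apply: smooth_on_invmx; first exact: UG.
      by move=> i l; apply: smooth_on_sub (CG i l).
    case: (split_ordP k) => i ->.
      apply: (@smooth_on_eq R _ RL _ (fun t : product (product M (Eu n2)) (Eu n) =>
        t.1.2 0 i + - b t.1.1 0 i)).
        by move=> t _; rewrite row_mxEl !mxE.
      apply: smooth_on_add; first exact: smooth_on_coord.
      apply: smooth_on_opp.
      apply: (smooth_on_comp (fun t Ut => UV _ (in1 t Ut)) C1 (Cmap 0 i)).
    apply: (@smooth_on_eq R _ RL _ (fun t : product (product M (Eu n2))
        (Eu n) => t.2 0 i)).
      by move=> t _; rewrite row_mxEr.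
    exact: smooth_on_coord.
  + exact: triv_inv_smooth T.
- apply: smooth_on_row => j.
  apply: (@smooth_on_eq R E RL _ (fun a => \sum_k w a 0 k * Tm k j)).
    by move=> a _; rewrite mxE.
  apply: smooth_on_sum => k _; apply: smooth_on_mul; last exact: smooth_on_const.
  apply: smooth_on_coord; apply: smooth_on_sub (triv_smooth T).
  by move=> a [Ea Ua pa]; split=> //=; rewrite pa; exact/VO/UV.
- move=> x z c Ux.
  have Ap := pi2_carrier (E_tau x z c Ux).
  have qp : q2 (p2 (tau x z c)) = x by rewrite -(base_eq dD) ?p1_tau ?q1y//;
      exact: E_tau.
  have [wz _] := wp2_tau x z c Ux.
  by rewrite -(trivK T2 Ap) qp ?wz//; case: Ux => -[].
- by move=> x z c Ux; case: (wp2_tau x z c Ux).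
- move=> a Ea Ua pa; rewrite /tau -pa.
  have := wG _ a Ua Ea pa => <-; rewrite mulmxK; last exact: UG.
  by rewrite (trivK T)// pa; exact/VO/UV.
- move=> a c l Ea Ec ac Ua pa; rewrite /kappa (triv_aff T)//.
    by rewrite /affR mulmxDl -!scalemxAl.
  by rewrite -ac pa; exact/VO/UV.
Qed.

End SectionLemma.

(** * Coordinates on a double affine bundle over a small open set *)

Section LocalChart.
Variable R : realType.
Local Notation RL := (real_line R).
Local Notation Eu n := (euclidean R n).
Variables (E A1 A2 M : Defs.space R) (p1 : bundle E A1) (p2 : bundle E A2)
  (q2 : bundle A2 M) (q1 : bundle A1 M).
Hypothesis dD : double_affine_bundle (DBundle p1 p2 q2 q1).

Let mE := affine_bundle_charted_tot (affine_pi1 dD).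
Let mA1 := affine_bundle_charted_base (affine_pi1 dD).
Let mA2 := affine_bundle_charted_base (affine_pi2 dD).
Let mM := affine_bundle_charted_base (affine_q1 dD).
#[local] Existing Instance mE.
#[local] Existing Instance mA1.
#[local] Existing Instance mA2.
#[local] Existing Instance mM.
Let cl1 := affine_bundle_closed (affine_pi1 dD).
Let cl2 := affine_bundle_closed (affine_pi2 dD).

Variables (n1 : nat) (U1 : set M) (w1 : A1 -> 'rV[R]_n1) (Psi1 : M ->
    'rV[R]_n1 -> A1).
Hypothesis T1 : trivialization q1 U1 w1 Psi1.
Variables (n2 : nat) (U2 : set M) (w2 : A2 -> 'rV[R]_n2) (Psi2 : M ->
    'rV[R]_n2 -> A2).
Hypothesis T2 : trivialization q2 U2 w2 Psi2.
Variables (n : nat) (U : set M).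
Variables (tau0 : M -> 'rV[R]_n2 -> 'rV[R]_n -> E) (kappa0 : E -> 'rV[R]_n).
Variables (tau : 'I_n1 -> M -> 'rV[R]_n2 -> 'rV[R]_n -> E)
  (kappa : 'I_n1 -> E -> 'rV[R]_n).
Hypothesis S0 : slice p1 p2 q1 U2 w2 Psi2 (Psi1^~ 0) U tau0 kappa0.
Hypothesis S1 : forall i,
  slice p1 p2 q1 U2 w2 Psi2 (Psi1^~ 'e_i) U (tau i) (kappa i).
Hypothesis UU1 : U `<=` U1.

Let UU2 : U `<=` U2. Proof. exact: slice_base S0. Qed.
Let oU : open U. Proof. exact: slice_open S0. Qed.

(** [tau0] and [tau i] are the slices over the origin and over the i-th basis
    vector of the coordinates [y]. In the fibre of [p2] over [(x, z)], [slide]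
    adds the vector [sum_i y_i [tau0 x z 0, tau i x z 0]], which moves the
    coordinate of [p1 a] by [y]: it identifies the slice over the origin with
    the slices over all other points. *)
Definition slide (x : M) (y : 'rV[R]_n1) (z : 'rV[R]_n2) (a : E) : E :=
  translates p2 (tau0 x z 0) (fun i => tau i x z 0) (fun i => y 0 i) (enum 'I_n1) a.

Lemma slide_closed x y z a : U x -> carrier E a -> p2 a = Psi2 x z ->
  carrier E (slide x y z a) /\ p2 (slide x y z a) = Psi2 x z.
Proof.
move=> Ux Ea pa; rewrite -pa; apply: (translates_closed cl2) => // [|i||i].
- exact: (slice_carrier S0).
- exact: (slice_carrier (S1 i)).
- by rewrite (slice_proj2 S0).
- by rewrite (slice_proj2 (S1 i)).
Qed.

Lemma slide_p1 x y z a : U x -> carrier E a -> p2 a = Psi2 x z ->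
  w1 (p1 (slide x y z a)) = w1 (p1 a) + y.
Proof.
move=> Ux Ea pa.
have E0 : carrier E (tau0 x z 0) by exact: (slice_carrier S0).
have Ei i : carrier E (tau i x z 0) by exact: (slice_carrier (S1 i)).
have qa : q1 (p1 a) = x by rewrite (base_eq dD)// pa (triv_proj T2)//; exact: UU2.
have A1c b : carrier E b -> carrier A1 (p1 b) by exact: (affine_bundle_proj
    (affine_pi1 dD)).
have Ux1 := UU1 Ux.
rewrite /slide (morph_translates cl2 (pi1_morphism dD))//; first last.
- by move=> i; rewrite (slice_proj2 (S1 i)).
- by rewrite (slice_proj2 S0).
rewrite (triv_translates (affine_q1 dD) T1) ?qa//; first last.
- by move=> i; rewrite /= (slice_proj1 (S1 i))// (triv_proj T1).
- by rewrite (slice_proj1 S0)// (triv_proj T1).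
- by move=> i; exact: A1c.
- exact: A1c.
- exact: A1c.
congr (_ + _); rewrite big_enum /= [RHS]row_sum_delta; apply: eq_bigr => i _.
by rewrite (slice_proj1 (S1 i))// (slice_proj1 S0)// !(triv_invK T1)// subr0.
Qed.

Lemma slide_coord m (V : set A2) (w : E -> 'rV[R]_m) Psi x y z a :
  trivialization p2 V w Psi -> V (Psi2 x z) -> U x -> carrier E a ->
      p2 a = Psi2 x z ->
  w (slide x y z a) = w a + \sum_i y 0 i *: (w (tau i x z 0) - w (tau0 x z 0)).
Proof.
move=> T V2 Ux Ea pa; rewrite /slide (triv_translates (affine_pi2 dD) T) ?pa//;
    first last.
- by move=> i; rewrite (slice_proj2 (S1 i)).
- by rewrite (slice_proj2 S0).
- by move=> i; exact: (slice_carrier (S1 i)).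
- exact: (slice_carrier S0).
by rewrite big_enum.
Qed.

Lemma slideNK x y z a : U x -> carrier E a -> p2 a = Psi2 x z ->
  slide x (- y) z (slide x y z a) = a.
Proof.
move=> Ux Ea pa; have [Eb pb] := slide_closed y Ux Ea pa.
have [Ec pc] := slide_closed (- y) Ux Eb pb.
apply: (fibre_ext (affine_pi2 dD)) => //; first by rewrite pc.
rewrite pa => m V w Psi T V2; rewrite (slide_coord _ T)//
    (slide_coord _ T)// -addrA -big_split /=.
by rewrite big1 ?addr0// => i _; rewrite mxE scaleNr addrN.
Qed.

Lemma slideKN x y z a : U x -> carrier E a -> p2 a = Psi2 x z ->
  slide x y z (slide x (- y) z a) = a.
Proof. by move=> Ux Ea pa; rewrite -{1}(opprK y) slideNK. Qed.

Lemma psi1_proj x v : U x -> q1 (Psi1 x v) = x.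
Proof. by move=> /UU1 Ux; rewrite (triv_proj T1). Qed.

(** The vectors used by [slide] depend on [z], but affinely, and with the same
    coefficients [y] on both sides: the interchange law applies. *)
Lemma slide_aff1 x y z z' a a' l : U x -> carrier E a -> carrier E a' ->
  p2 a = Psi2 x z -> p2 a' = Psi2 x z' -> p1 a = p1 a' ->
  aff p1 (slide x y z a) (slide x y z' a') l =
  slide x y (affR z z' l) (aff p1 a a' l).
Proof.
move=> Ux Ea Ea' pa pa' aa'; rewrite /slide.
rewrite (interchange_translates dD)//; first last.
- by move=> i; rewrite !(slice_proj1 (S1 i)).
- by rewrite !(slice_proj1 S0).
- by move=> i; rewrite (slice_proj2 (S1 i)).
- by rewrite (slice_proj2 S0).
- by move=> i; rewrite (slice_proj2 (S1 i)).
- by rewrite (slice_proj2 S0).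
- by move=> i; exact: (slice_carrier (S1 i)).
- exact: (slice_carrier S0).
- by move=> i; exact: (slice_carrier (S1 i)).
- exact: (slice_carrier S0).
have a0 : affR 0 0 l = 0 :> 'rV[R]_n by rewrite /affR !scaler0 addr0.
congr translates.
  by rewrite -{3}a0 (slice_aff dD T2 _ _ _ _ _ S0)// => u; exact: psi1_proj.
apply/funext => i.
by rewrite -{3}a0 (slice_aff dD T2 _ _ _ _ _ (S1 i))// => u; exact: psi1_proj.
Qed.

(** Here everything happens in one fibre of [p2], in which [slide] is a
    translation by a vector that is linear in [y]. *)
Lemma slide_aff2 x y y' z a b l : U x -> carrier E a -> carrier E b ->
  p2 a = Psi2 x z -> p2 b = Psi2 x z ->
  slide x (affR y y' l) z (aff p2 a b l) = aff p2 (slide x y z a)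
      (slide x y' z b) l.
Proof.
move=> Ux Ea Eb pa pb.
have [E1 e1] := cl2 l Ea Eb (etrans pa (esym pb)); rewrite pa in e1.
have [E2 e2] := slide_closed y Ux Ea pa; have [E3 e3] := slide_closed y' Ux Eb pb.
have [E4 e4] := cl2 l E2 E3 (etrans e2 (esym e3)); rewrite e2 in e4.
have [E5 e5] := slide_closed (affR y y' l) Ux E1 e1.
apply: (fibre_ext (affine_pi2 dD)) => //; first by rewrite e4.
rewrite e4 => m V w Psi T V2.
rewrite (triv_aff T) ?e2 ?e3// !(slide_coord _ T)// (triv_aff T) ?pa ?pb//.
rewrite /affR !scalerDr !scaler_sumr addrACA -big_split /=; congr (_ + _).
by apply: eq_bigr => i _; rewrite !mxE !scalerA -scalerDl.
Qed.

Lemma smooth_on_slice X {mX : charted X} (S : set X) y V t k (x : X -> M)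
    (z : X -> 'rV[R]_n2) (c : X -> 'rV[R]_n) :
  slice p1 p2 q1 U2 w2 Psi2 y V t k ->
  smooth_in X M S x -> smooth_in X (Eu n2) S z -> smooth_in X (Eu n) S c ->
  (forall s, S s -> V (x s)) -> smooth_in X E S (fun s => t (x s) (z s) (c s)).
Proof.
move=> Sl Cx Cz Cc SV.
apply: (@smooth_on_comp R X (product (product M (Eu n2)) (Eu n)) E _ _ _ _
  (V `*` setT `*` setT) (fun s => (x s, z s, c s)) (fun b => t b.1.1 b.1.2 b.2)).
- by move=> s /SV.
- by apply: smooth_on_pair => //; exact: smooth_on_pair.
- exact: slice_smooth Sl.
Qed.

Lemma smooth_on_slide X {mX : charted X} (S : set X) (x : X -> M) (y : X ->
    'rV[R]_n1)
    (z : X -> 'rV[R]_n2) (a : X -> E) :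
  smooth_in X M S x -> smooth_in X (Eu n1) S y -> smooth_in X (Eu n2) S z ->
      smooth_in X E S a ->
  (forall s, S s -> [/\ U (x s), carrier E (a s) & p2 (a s) = Psi2 (x s) (z s)]) ->
  smooth_in X E S (fun s => slide (x s) (y s) (z s) (a s)).
Proof.
move=> Cx Cy Cz Ca H.
have C0 : smooth_in X (Eu n) S (fun=> 0) by exact: (@smooth_on_cst R X (Eu n)).
have HU s : S s -> U (x s) by case/H.
apply: (smooth_on_translates (affine_pi2 dD) (enum 'I_n1) (f := a) (q0 :=
    fun s => tau0 (x s) (z s) 0)
  (q := fun i s => tau i (x s) (z s) 0) (h := fun i s => y s 0 i)) => //.
- exact: (smooth_on_slice S0 Cx Cz C0 HU).
- by move=> i; exact: (smooth_on_slice (S1 i) Cx Cz C0 HU).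
- by move=> i; exact: smooth_on_coord.
- by move=> s /H[].
- by move=> s /HU Us; exact: (slice_carrier S0).
- by move=> i s /HU Us; exact: (slice_carrier (S1 i)).
- by move=> s /H[Us _ ->]; rewrite (slice_proj2 S0).
- by move=> i s /H[Us _ ->]; rewrite (slice_proj2 (S1 i)).
Qed.

(** The coordinate [c] of a point is that of its image in the slice over the
    origin. *)
Definition local_coords (a : E) : M * 'rV[R]_n1 * 'rV[R]_n2 * 'rV[R]_n :=
  (q1 (p1 a), w1 (p1 a), w2 (p2 a),
   kappa0 (slide (q1 (p1 a)) (- w1 (p1 a)) (w2 (p2 a)) a)).

Definition local_param (t : M * 'rV[R]_n1 * 'rV[R]_n2 * 'rV[R]_n) : E :=
  slide t.1.1.1 t.1.1.2 t.1.2 (tau0 t.1.1.1 t.1.2 t.2).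

Lemma pi2_coords a : carrier E a -> U (q1 (p1 a)) -> p2 a = Psi2 (q1 (p1 a)) (w2
    (p2 a)).
Proof.
move=> Ea Ua; have Ap := affine_bundle_proj (affine_pi2 dD) Ea.
by rewrite (base_eq dD)// (trivK T2)// -(base_eq dD)//; exact: UU2.
Qed.

Lemma pi1_coords a : carrier E a -> U (q1 (p1 a)) -> p1 a = Psi1 (q1 (p1 a)) (w1
    (p1 a)).
Proof.
move=> Ea Ua; have Ap := affine_bundle_proj (affine_pi1 dD) Ea.
by rewrite (trivK T1)//; exact: UU1.
Qed.

(** This puts the point on the slice over the origin, the domain of [kappa0]. *)
Lemma slide_origin a : carrier E a -> U (q1 (p1 a)) ->
  let x := q1 (p1 a) in let a0 := slide x (- w1 (p1 a)) (w2 (p2 a)) a in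
  [/\ carrier E a0, q1 (p1 a0) = x, p1 a0 = Psi1 x 0 & p2 a0 = p2 a].
Proof.
move=> Ea Ua /=; have pa := pi2_coords Ea Ua.
have [E0 e0] := slide_closed (- w1 (p1 a)) Ua Ea pa; rewrite -pa in e0.
have qa0 : q1 (p1 (slide (q1 (p1 a)) (- w1 (p1 a)) (w2 (p2 a)) a)) = q1 (p1 a).
  by rewrite (base_eq dD)// e0 -(base_eq dD).
split=> //.
by rewrite pi1_coords ?qa0// slide_p1// addrN.
Qed.

Lemma local_paramK x y z c : U x ->
  [/\ carrier E (local_param (x, y, z, c)), q1 (p1 (local_param (x, y, z, c))) = x &
      local_coords (local_param (x, y, z, c)) = (x, y, z, c)].
Proof.
move=> Ux; rewrite /local_param /=.
have Et := slice_carrier S0 z c Ux; have p1t := slice_proj1 S0 z c Ux.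
have p2t := slice_proj2 S0 z c Ux.
have [Em pm] := slide_closed y Ux Et p2t.
have qm : q1 (p1 (slide x y z (tau0 x z c))) = x.
  by rewrite (base_eq dD)// pm (triv_proj T2)//; exact: UU2.
split=> //; rewrite /local_coords qm pm (triv_invK T2)//; last exact: UU2.
rewrite slide_p1// p1t (triv_invK T1)//; last exact: UU1.
by rewrite add0r slideNK// (slice_coordK S0).
Qed.

Lemma local_coordsK a : carrier E a -> U (q1 (p1 a)) -> local_param
    (local_coords a) = a.
Proof.
move=> Ea Ua; have /= [E0 q0 p10 p20] := slide_origin Ea Ua.
have := sliceK S0 E0; rewrite q0 p20 => /(_ Ua p10) E1.
by rewrite /local_param /local_coords /= E1 slideKN//; exact: pi2_coords.
Qed.

Lemma local_coords_aff1 a b l : carrier E a -> carrier E b -> U (q1 (p1 a)) ->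
  p1 a = p1 b ->
  local_coords (aff p1 a b l) = (q1 (p1 a), w1 (p1 a), affR (w2 (p2 a)) (w2
      (p2 b)) l,
    affR (local_coords a).2 (local_coords b).2 l).
Proof.
move=> Ea Eb Ua ab; have [E1 e1] := cl1 l Ea Eb ab.
have Ub : U (q1 (p1 b)) by rewrite -ab.
have Ap c : carrier E c -> carrier A2 (p2 c) by exact: (affine_bundle_proj
    (affine_pi2 dD)).
have w2E : w2 (p2 (aff p1 a b l)) = affR (w2 (p2 a)) (w2 (p2 b)) l.
  rewrite (morph_aff (pi2_morphism dD))// (triv_aff T2) -?(base_eq dD) ?ab//;
      try exact: Ap.
  by apply: UU2.
rewrite /local_coords e1 w2E; congr (_, _, _, _) => /=.
have [E2 q2E p12 p22] := slide_origin Ea Ua; have [E3 q3 p13 p23] :=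
    slide_origin Eb Ub.
have pa := pi2_coords Ea Ua; have pb := pi2_coords Eb Ub; rewrite -ab in pb.
rewrite ab in E2 q2E p12.
rewrite -slide_aff1// (slice_coord_aff S0)// ?ab//.
- by rewrite p12 p13.
- by rewrite q2E.
- by rewrite q2E p12.
Qed.

(** Slid back to the origin, [a] and [b] lie in the same fibre of [p1] as well.
    Sliding is affine for [p2] whereas [kappa0] is affine for [p1]; on such
    points the two structures coincide by [aff_agree]. *)
Lemma local_coords_aff2 a b l : carrier E a -> carrier E b -> U (q1 (p1 a)) ->
  p2 a = p2 b ->
  local_coords (aff p2 a b l) = (q1 (p1 a), affR (w1 (p1 a)) (w1 (p1 b)) l, w2
      (p2 a),
    affR (local_coords a).2 (local_coords b).2 l).
Proof.
move=> Ea Eb Ua ab; have [E1 e1] := cl2 l Ea Eb ab.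
have qab : q1 (p1 a) = q1 (p1 b) by rewrite !(base_eq dD)// ab.
have Ub : U (q1 (p1 b)) by rewrite -qab.
have Ap c : carrier E c -> carrier A1 (p1 c) by exact: (affine_bundle_proj
    (affine_pi1 dD)).
have qE : q1 (p1 (aff p2 a b l)) = q1 (p1 a).
  by rewrite (base_eq dD)// e1 -(base_eq dD).
have w1E : w1 (p1 (aff p2 a b l)) = affR (w1 (p1 a)) (w1 (p1 b)) l.
  rewrite (morph_aff (pi1_morphism dD))// (triv_aff T1)//; try exact: Ap.
  exact: UU1.
rewrite /local_coords qE w1E e1; congr (_, _, _, _) => /=.
have [E2 q2E p12 p22] := slide_origin Ea Ua; have [E3 q3 p13 p23] :=
    slide_origin Eb Ub.
have pa := pi2_coords Ea Ua.
have pb : p2 b = Psi2 (q1 (p1 a)) (w2 (p2 a)) by rewrite -ab.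
rewrite -ab -qab in E3 q3 p13 p23; rewrite -ab -qab.
have -> : - affR (w1 (p1 a)) (w1 (p1 b)) l = affR (- w1 (p1 a)) (- w1 (p1 b)) l.
  by rewrite /affR opprD !scalerN.
rewrite slide_aff2// -(aff_agree dD)//; first last.
- by rewrite p22 p23.
- by rewrite p12 p13.
rewrite (slice_coord_aff S0)// ?q2E//.
by rewrite p12 p13.
Qed.

Let X4 := product (product (product M (Eu n1)) (Eu n2)) (Eu n).

Lemma smooth_on_local_coords : smooth_in E X4 (carrier E `&`
    (q2 \o p2) @^-1` U) local_coords.
Proof.
set S := _ `&` _.
have SE a : S a -> carrier E a by case.
have SU a : S a -> U (q1 (p1 a)) by case=> Ea /=; rewrite (base_eq dD).
have Cid : smooth_in E E S id by exact: smooth_on_id.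
have Cp1 : smooth_in E A1 S p1.
  exact: (smooth_on_comp SE Cid (affine_bundle_smooth (affine_pi1 dD))).
have Cp2 : smooth_in E A2 S p2.
  exact: (smooth_on_comp SE Cid (affine_bundle_smooth (affine_pi2 dD))).
have Sp1 a : S a -> (carrier A1 `&` q1 @^-1` U1) (p1 a).
  move=> Sa; split; last by apply: UU1; exact: SU.
  by apply: (affine_bundle_proj (affine_pi1 dD)); exact: SE.
have Sp2 a : S a -> (carrier A2 `&` q2 @^-1` U2) (p2 a).
  move=> Sa; split; last by apply: UU2; case: Sa.
  by apply: (affine_bundle_proj (affine_pi2 dD)); exact: SE.
have Ap1 a : S a -> carrier A1 (p1 a) by case/Sp1.
have Cq : smooth_in E M S (fun a => q1 (p1 a)).
  exact: (smooth_on_comp Ap1 Cp1 (affine_bundle_smooth (affine_q1 dD))).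
have Cw1 : smooth_in E (Eu n1) S (fun a => w1 (p1 a)).
  exact: (smooth_on_comp Sp1 Cp1 (triv_smooth T1)).
have Cw2 : smooth_in E (Eu n2) S (fun a => w2 (p2 a)).
  exact: (smooth_on_comp Sp2 Cp2 (triv_smooth T2)).
apply: smooth_on_pair; first by apply: smooth_on_pair => //; exact: smooth_on_pair.
apply: (smooth_on_comp _ _ (slice_coord_smooth S0)).
  move=> a Sa; have [E0 q0 e0 _] := slide_origin (SE _ Sa) (SU _ Sa).
  by split=> //; rewrite q0//; exact: SU.
apply: smooth_on_slide => //.
  apply: smooth_on_row => j.
  apply: (@smooth_on_eq R E RL S (fun a => - w1 (p1 a) 0 j)).
    by move=> a _; rewrite mxE.
  by apply: smooth_on_opp; exact: smooth_on_coord.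
move=> a Sa; have [Ea Ua] := (SE _ Sa, SU _ Sa).
by split=> //; exact: pi2_coords.
Qed.

Lemma smooth_on_local_param : smooth_in X4 E (U `*` setT `*` setT `*` setT)
    local_param.
Proof.
set S := U `*` _ `*` _ `*` _.
have Cid : smooth_in X4 X4 S id by exact: smooth_on_id.
have C1 : smooth_in X4 (product (product M (Eu n1)) (Eu n2)) S (fun t => t.1).
  exact: smooth_on_fst Cid.
have C2 : smooth_in X4 (product M (Eu n1)) S (fun t => t.1.1) by exact:
    smooth_on_fst C1.
have Cx : smooth_in X4 M S (fun t => t.1.1.1) by exact: smooth_on_fst C2.
have Cy : smooth_in X4 (Eu n1) S (fun t => t.1.1.2) by exact: smooth_on_snd C2.
have Cz : smooth_in X4 (Eu n2) S (fun t => t.1.2) by exact: smooth_on_snd C1.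
have Cc : smooth_in X4 (Eu n) S (fun t => t.2) by exact: smooth_on_snd Cid.
have SU (t : X4) : S t -> U t.1.1.1 by case=> -[[]].
apply: smooth_on_slide => //; first exact: smooth_on_slice S0 Cx Cz Cc SU.
move=> t /SU Ut; split=> //; first exact: (slice_carrier S0).
by rewrite (slice_proj2 S0).
Qed.

End LocalChart.

Section TrivialisationIso.
Variable R : realType.
Local Notation Eu n := (euclidean R n).

Lemma triv_iso (E B : Defs.space R) (p : bundle E B) n (U0 U : set B) w Psi :
  affine_bundle p -> @trivialization R E B p n U0 w Psi -> open U -> U `<=` U0 ->
  diffeo (E := restr (p @^-1` U)) (F := prod_space (restr U) (whole (Eu n)))
    (fun a => (p a, w a)) /\
  affine_morphism (restr_bundle p U) (trivial_bundle (restr U) n)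
    (fun a => (p a, w a)) id.
Proof.
move=> abp T oU UU0.
have mE := affine_bundle_charted_tot abp; have mB := affine_bundle_charted_base abp.
have Cid : smooth_map (E := restr U) (F := restr U) id.
  by split=> //; exact: smooth_on_id.
have CF : smooth_map (E := restr (p @^-1` U))
    (F := prod_space (restr U) (whole (Eu n))) (fun a => (p a, w a)).
  split; last first.
    by move=> a [Ea Ua]; split=> //; split=> //; exact: (affine_bundle_proj abp).
  apply: smooth_on_pair.
    by apply: smooth_on_sub (affine_bundle_smooth abp) => a [].
  by apply: smooth_on_sub (triv_smooth T) => a [Ea Ua]; split=> //; exact: UU0.
split.
  exists (fun t => Psi t.1 t.2); split=> //.
  - split.
      by apply: smooth_on_sub (triv_inv_smooth T) => -[x v] [/= [_ Ux] _];
          split=> //; exact: UU0.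
    move=> [x v] [/= [Bx Ux] _]; have Ux0 := UU0 _ Ux.
    by split; [exact: (triv_carrier T)|rewrite /= (triv_proj T)].
  - by move=> a [Ea Ua]; rewrite /= (trivK T)//; exact: UU0.
  - move=> [x v] [/= [Bx Ux] _]; have Ux0 := UU0 _ Ux.
    by rewrite (triv_proj T)// (triv_invK T).
split=> // a b l [Ea Ua] [Eb Ub] ab0.
have ab : p a = p b by exact: ab0.
rewrite /= (aff_proj (affine_bundle_closed abp))// (triv_aff T)//; last exact: UU0.
by rewrite ab.
Qed.

End TrivialisationIso.

(** * Existence of adapted charts *)

Section LocalTriviality.
Variable R : realType.
Local Notation RL := (real_line R).
Local Notation Eu n := (euclidean R n).

Definition adapted_chart (D : dbundle R) n1 n2 n (U : set (base D))
    (phi : tot D -> base D * 'rV[R]_n1 * 'rV[R]_n2 * 'rV[R]_n)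
    (psi : base D * 'rV[R]_n1 * 'rV[R]_n2 * 'rV[R]_n -> tot D) :=
  [/\ open U, U `<=` carrier (base D),
      diffeo_with_inverse (E := tot (restr_dbundle U))
        (F := tot (trivial_dbundle (restr U) n1 n2 n)) phi psi &
      dbundle_iso (D := restr_dbundle U)
        (D' := trivial_dbundle (restr U) n1 n2 n) phi id].

Section Construction.
Variables (E A1 A2 M : Defs.space R) (p1 : bundle E A1) (p2 : bundle E A2)
  (q2 : bundle A2 M) (q1 : bundle A1 M).
Hypothesis dD : double_affine_bundle (DBundle p1 p2 q2 q1).

Let mM := affine_bundle_charted_base (affine_q1 dD).
#[local] Existing Instance mM.

Lemma slices_adapted_chart n1 (U1 : set M) w1 Psi1 n2 (U2 : set M) w2 Psi2 n
    (U : set M)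
    tau0 kappa0 tau kappa :
  @trivialization R A1 M q1 n1 U1 w1 Psi1 -> @trivialization R A2 M q2 n2 U2 w2
      Psi2 ->
  @slice R E A1 A2 M p1 p2 q1 n2 U2 w2 Psi2 n (Psi1^~ 0) U tau0 kappa0 ->
  (forall i, slice p1 p2 q1 U2 w2 Psi2 (Psi1^~ 'e_i) U (tau i) (kappa i)) ->
  U `<=` U1 ->
  @adapted_chart (DBundle p1 p2 q2 q1) n1 n2 n U
      (local_coords p1 p2 q1 w1 w2 tau0 kappa0 tau)
    (local_param p2 tau0 tau).
Proof.
move=> T1 T2 S0 S1 UU1; have oU := slice_open S0; have UU2 := slice_base S0.
have UM : U `<=` carrier M by move=> x /UU2; exact: (triv_base T2).
set phi := local_coords _ _ _ _ _ _ _ _; set psi := local_param _ _ _.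
have SU a : carrier E a -> U (q2 (p2 a)) -> U (q1 (p1 a)).
  by move=> Ea; rewrite (base_eq dD).
have Cphi : smooth_map (E := tot (@restr_dbundle R (DBundle p1 p2 q2 q1) U))
    (F := tot (trivial_dbundle (restr U) n1 n2 n)) phi.
  split; first refine (smooth_on_local_coords dD T1 T2 S0 S1 UU1).
  move=> a [Ea Ua]; have Ua' := SU _ Ea Ua.
  exact: (conj (conj (conj (conj (UM _ Ua') Ua') I) I) I).
have Cpsi : smooth_map (E := tot (trivial_dbundle (restr U) n1 n2 n))
    (F := tot (@restr_dbundle R (DBundle p1 p2 q2 q1) U)) psi.
  split.
    apply: smooth_on_sub (smooth_on_local_param dD S0 S1).
    by move=> [[[x y] z] c] [[[[_ Ux] _] _] _].
  move=> [[[x y] z] c] [[[[_ Ux] _] _] _].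
  have [Ep qp _] := local_paramK dD T1 T2 S0 S1 UU1 y z c Ux.
  by split=> //=; rewrite -(base_eq dD)// qp.
have DP : diffeo_with_inverse (E := tot (@restr_dbundle R (DBundle p1 p2 q2 q1) U))
    (F := tot (trivial_dbundle (restr U) n1 n2 n)) phi psi.
  split=> //.
    by move=> a [Ea Ua]; apply: (local_coordsK dD T1 T2 S0 S1 UU1);
        [exact: Ea|exact: SU].
  move=> [[[x y] z] c] [[[[_ Ux] _] _] _].
  by have [_ _ K] := local_paramK dD T1 T2 S0 S1 UU1 y z c Ux; exact: K.
have [D1 M1] := triv_iso (affine_q1 dD) T1 oU UU1.
have [D2 M2] := triv_iso (affine_q2 dD) T2 oU UU2.
have Cid : smooth_map (E := restr U) (F := restr U) id.
  by split=> //; exact: smooth_on_id.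
split=> //; split; first by exists psi.
split; first by exists id; split.
exists (fun a => (q1 a, w1 a)), (fun a => (q2 a, w2 a)); split=> //.
- split=> //; first by have [g []] := D1.
  move=> a b l [Ea Ua] [Eb Ub] ab.
  rewrite [LHS](local_coords_aff1 dD T1 T2 S0 S1 UU1 l Ea Eb
      (SU _ Ea Ua) ab) /phi /local_coords /=.
  by have ab' : p1 a = p1 b := ab; rewrite -ab'.
- split=> //; first by have [g []] := D2.
    by move=> a [Ea Ua] /=; rewrite (base_eq dD).
  move=> a b l [Ea Ua] [Eb Ub] ab.
  rewrite [LHS](local_coords_aff2 dD T1 T2 S0 S1 UU1 l Ea Eb
      (SU _ Ea Ua) ab) /phi /local_coords /=.
  by have ab' : p2 a = p2 b := ab; rewrite !(base_eq dD)// -ab'.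
Qed.

Lemma slice_sub n2 (U2 : set M) (w2 : A2 -> 'rV[R]_n2) Psi2 n y
    (U V : set M) tau kappa :
  open V -> V `<=` U ->
  @slice R E A1 A2 M p1 p2 q1 n2 U2 w2 Psi2 n y U tau kappa ->
  slice p1 p2 q1 U2 w2 Psi2 y V tau kappa.
Proof.
move=> oV VU S; have VUx x := VU x; split=> //.
- by move=> x /VU; exact: (slice_base S).
- by apply: smooth_on_sub (slice_smooth S) => -[[x z] c] [[/= /VU Ux _] _].
- by apply: smooth_on_sub (slice_coord_smooth S) => a [Ea /VU Ua pa].
- by move=> x z c /VU; exact: (slice_carrier S).
- by move=> x z c /VU; exact: (slice_proj1 S).
- by move=> x z c /VU; exact: (slice_proj2 S).
- by move=> x z c /VU; exact: (slice_coordK S).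
- by move=> a Ea /VU; exact: (sliceK S).
- by move=> a b l Ea Eb ab /VU; exact: (slice_coord_aff S).
Qed.

(** The rank of [p1] is at least that of [q2], since [p2] maps the fibres of
    [p1] onto those of [q2]; the difference is the dimension of [K]. Slices over
    the origin and the basis vectors suffice, so finitely many neighbourhoods
    are intersected. *)
Lemma adapted_chart_exists : exists n1 n2 n, forall x, carrier M x ->
  exists U phi psi, U x /\ @adapted_chart (DBundle p1 p2 q2 q1) n1 n2 n U phi psi.
Proof.
have [[x1 Mx1]|nM] := pselect (exists x, carrier M x); last first.
  by exists 0%N, 0%N, 0%N => x Mx; case: nM; exists x.
have [n1 HT1] := triv_exists (affine_q1 dD).
have [n2 HT2] := triv_exists (affine_q2 dD).
have [N HT] := triv_exists (affine_pi1 dD).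
have N2 : (n2 <= N)%N.
  have [U1 [w1 [Psi1 [U1x T1]]]] := HT1 _ Mx1.
  have [U2 [w2 [Psi2 [U2x T2]]]] := HT2 _ Mx1.
  have [Q [w [Xi [Qa T]]]] := HT _ (triv_carrier T1 0 U1x).
  by apply: (fibre_rank dD T2 T Qa); rewrite (triv_proj T1).
have [n EN] : exists n, N = (n2 + n)%N.
  by exists (N - n2)%N; rewrite subnKC.
subst N; exists n1, n2, n => x Mx.
have [U1 [w1 [Psi1 [U1x T1]]]] := HT1 _ Mx.
have [U2 [w2 [Psi2 [U2x T2]]]] := HT2 _ Mx.
have mA1 := affine_bundle_charted_base (affine_pi1 dD).
have sl v : exists U tau kappa, [/\ U x, U `<=` U1 &
    @slice R E A1 A2 M p1 p2 q1 n2 U2 w2 Psi2 n (Psi1^~ v) U tau kappa].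
  have [Q [w [Xi [Qa T]]]] := HT _ (triv_carrier T1 v U1x).
  apply: (slice_exists dD T2 T (triv_open T1)) => //.
    apply: (@smooth_on_comp R M (product M (Eu n1)) A1 _ _ _ _ (U1 `*` setT)
      (fun x => (x, v)) (fun b => Psi1 b.1 b.2)).
    - by [].
    - by apply: smooth_on_pair; [exact: smooth_on_id|exact: (@smooth_on_cst R M
        (Eu n1))].
    - exact: triv_inv_smooth T1.
  by move=> u; exact: (triv_proj T1).
have [V0 [tau0 [kappa0 [V0x V01 S0]]]] := sl 0.
have /choice[V /choice[tau /choice[kappa H]]] :
  forall i : 'I_n1, exists U tau kappa, [/\ U x, U `<=` U1 &
    @slice R E A1 A2 M p1 p2 q1 n2 U2 w2 Psi2 n (Psi1^~ 'e_i) U tau kappa].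
  by move=> i; exact: sl.
pose U := (fun u => V0 u /\ forall i, V i u)°.
have oU : open U by exact: open_interior.
have UV0 : U `<=` V0 by move=> u /interior_subset[].
have UV i : U `<=` V i by move=> u /interior_subset[].
exists U, (local_coords p1 p2 q1 w1 w2 tau0 kappa0 tau),
    (local_param p2 tau0 tau); split.
  apply: filterI; first by apply: open_nbhs_nbhs; split=> //; exact: slice_open S0.
  apply: filter_forall => i; have [Vx _ Si] := H i.
  by apply: open_nbhs_nbhs; split=> //; exact: slice_open Si.
apply: (slices_adapted_chart T1 T2 (slice_sub oU UV0 S0) (kappa := kappa)) =>
    [i|u /UV0/V01//].
by have [_ _ Si] := H i; exact: slice_sub oU (UV i) Si.
Qed.

End Construction.
End LocalTriviality.

(** * Transition functions *)

Section Biaffine.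
Variable R : realType.

Lemma affR_coord N m (F : 'rV[R]_N -> 'rV[R]_m) :
  (forall v v' l, F (affR v v' l) = affR (F v) (F v') l) ->
  forall v j, F v 0 j = F 0 0 j + \sum_k (F 'e_k 0 j - F 0 0 j) * v 0 k.
Proof.
move=> /affR_linear HF v j; rewrite HF !mxE; congr (_ + _).
by apply: eq_bigr => k _; rewrite !mxE mulrC.
Qed.

(** The point [(z, c)] is the affine combination with weights 2 and -1 of the
    midpoint of [(z, 0)] and [(0, c)] and of the origin. *)
Lemma affR_split a b m (F : 'rV[R]_a -> 'rV[R]_b -> 'rV[R]_m) :
  (forall z z' c c' l, F (affR z z' l) (affR c c' l) = affR (F z c) (F z' c') l) ->
  forall z c, F z c = F z 0 + F 0 c - F 0 0.
Proof.
move=> HF z c.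
have := HF (affR z 0 2^-1) 0 (affR 0 c 2^-1) 0 2; rewrite [in RHS]HF.
have -> : affR (affR z 0 2^-1) 0 2 = z by apply/rowP => j; rewrite !mxE; field.
have -> : affR (affR 0 c 2^-1) 0 2 = c by apply/rowP => j; rewrite !mxE; field.
by move=> ->; apply/rowP => j; rewrite !mxE; field.
Qed.

(** Affinity in [(z, c)] and in [(y, c)] together force the coefficients of [c]
    to be constant, leaving only terms in [y], [z] and the products [y_k z_b].
    *)
Lemma biaffine_coord n1 n2 n m
    (F : 'rV[R]_n1 -> 'rV[R]_n2 -> 'rV[R]_n -> 'rV[R]_m) :
  (forall y z z' c c' l,
     F y (affR z z' l) (affR c c' l) = affR (F y z c) (F y z' c') l) ->
  (forall y y' z c c' l,
     F (affR y y' l) z (affR c c' l) = affR (F y z c) (F y' z c') l) ->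
  forall y z c u, F y z c 0 u = F 0 0 0 0 u
    + \sum_k (F 'e_k 0 0 0 u - F 0 0 0 0 u) * y 0 k
    + \sum_b (F 0 'e_b 0 0 u - F 0 0 0 0 u) * z 0 b
    + \sum_k \sum_b (F 'e_k 'e_b 0 0 u - F 'e_k 0 0 0 u
        - (F 0 'e_b 0 0 u - F 0 0 0 0 u)) * y 0 k * z 0 b
    + \sum_w (F 0 0 'e_w 0 u - F 0 0 0 0 u) * c 0 w.
Proof.
move=> H1 H2 y z c u.
have a0 k l : affR 0 0 l = 0 :> 'rV[R]_k by rewrite /affR !scaler0 addr0.
have Ey z' : forall y j, F y z' 0 0 j = F 0 z' 0 0 j +
    \sum_k (F 'e_k z' 0 0 j - F 0 z' 0 0 j) * y 0 k.
  by apply: (affR_coord (F := fun y => F y z' 0)) => v v' l;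
      rewrite -(H2 v v' z' 0 0 l) a0.
have Ez y' : forall z j, F y' z 0 0 j = F y' 0 0 0 j +
    \sum_k (F y' 'e_k 0 0 j - F y' 0 0 0 j) * z 0 k.
  by apply: (affR_coord (F := fun z => F y' z 0)) => v v' l;
      rewrite -(H1 y' v v' 0 0 l) a0.
have Ec : forall c j, F 0 0 c 0 j = F 0 0 0 0 j +
    \sum_k (F 0 0 'e_k 0 j - F 0 0 0 0 j) * c 0 k.
  by apply: (affR_coord (F := F 0 0)) => v v' l; rewrite -(H1 0 0 0 v v' l) a0.
have -> : F y z c = F y z 0 + F 0 0 c - F 0 0 0.
  rewrite (affR_split (F := F y)) => [|*]; last exact: H1.
  rewrite (affR_split (F := fun y c => F y 0 c) _ y c) => [|*]; last exact: H2.
  by apply/rowP => j; rewrite !mxE; ring.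
rewrite !mxE (Ec c u) (Ez y z u) (Ey 0 y u).
rewrite [in RHS]exchange_big /=.
have -> : \sum_b (F y 'e_b 0 0 u -
      (F 0 0 0 0 u + \sum_k (F 'e_k 0 0 0 u - F 0 0 0 0 u) * y 0 k)) * z 0 b =
   \sum_b (F 0 'e_b 0 0 u - F 0 0 0 0 u) * z 0 b +
   \sum_b \sum_k (F 'e_k 'e_b 0 0 u - F 'e_k 0 0 0 u
        - (F 0 'e_b 0 0 u - F 0 0 0 0 u)) * y 0 k * z 0 b.
  rewrite -big_split /=; apply: eq_bigr => b _.
  rewrite (Ey 'e_b y u) opprD addrACA -sumrB mulrDl; congr (_ + _).
  by rewrite mulr_suml; apply: eq_bigr => k _; ring.
ring.
Qed.

End Biaffine.

Section Transition.
Variable R : realType.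
Local Notation RL := (real_line R).
Local Notation Eu n := (euclidean R n).
Variables (E A1 A2 M : Defs.space R) (p1 : bundle E A1) (p2 : bundle E A2)
  (q2 : bundle A2 M) (q1 : bundle A1 M).
Hypothesis dD : double_affine_bundle (DBundle p1 p2 q2 q1).

Let mE := affine_bundle_charted_tot (affine_pi1 dD).
Let mM := affine_bundle_charted_base (affine_q1 dD).
#[local] Existing Instance mE.
#[local] Existing Instance mM.

Variables (n1 n2 n : nat).
Local Notation coords := (M * 'rV[R]_n1 * 'rV[R]_n2 * 'rV[R]_n)%type.
Let D := DBundle p1 p2 q2 q1.

Section OneChart.
Variables (U : set M) (phi : E -> coords) (psi : coords -> E).
Hypothesis C : @adapted_chart R D n1 n2 n U phi psi.

Lemma adapted_chart_psiK t : U t.1.1.1 ->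
  [/\ carrier E (psi t), U (q2 (p2 (psi t))) & phi (psi t) = t].
Proof.
move=> Ut; have [oU UM [[_ Hphi] [_ Hpsi] K1 K2] _] := C.
have Ct : carrier (tot (trivial_dbundle (restr (E := M) U) n1 n2 n)) t.
  by move: t Ut => [[[x y] z] c] /= Ux; exact: (conj (conj (conj (conj
      (UM _ Ux) Ux) I) I) I).
by have [Ep Up] := Hpsi _ Ct; split=> //; exact: K2.
Qed.

Lemma adapted_chart_phiK a : carrier E a -> U (q2 (p2 a)) -> psi (phi a) = a.
Proof.
by move=> Ea Ua; have [_ _ [_ _ K _] _] := C; apply: K.
Qed.

(** What an adapted chart does to fibres and to affine combinations, in terms of
    the components of [phi a]. *)
Lemma adapted_chart_morph : exists (f1 : A1 -> M * 'rV[R]_n1) (f2 : A2 ->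
    M * 'rV[R]_n2),
  [/\ [/\ (forall a, carrier E a -> U (q2 (p2 a)) -> (phi a).1.1 = f1 (p1 a)),
           (forall a, carrier A1 a -> U (q1 a) -> (f1 a).1 = q1 a) &
           (forall a b, carrier A1 a -> carrier A1 b -> U (q1 a) -> U (q1 b) ->
              f1 a = f1 b -> a = b)],
      [/\ (forall a, carrier E a -> U (q2 (p2 a)) ->
              ((phi a).1.1.1, (phi a).1.2) = f2 (p2 a)) &
           (forall a b, carrier A2 a -> carrier A2 b -> U (q2 a) -> U (q2 b) ->
              f2 a = f2 b -> a = b)],
      (forall a b l, carrier E a -> carrier E b -> U (q2 (p2 a)) ->
         U (q2 (p2 b)) -> p1 a = p1 b ->
         phi (aff p1 a b l) = ((phi a).1.1.1, (phi a).1.1.2,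
           affR (phi a).1.2 (phi b).1.2 l, affR (phi a).2 (phi b).2 l)) &
      (forall a b l, carrier E a -> carrier E b -> U (q2 (p2 a)) ->
         U (q2 (p2 b)) -> p2 a = p2 b ->
         phi (aff p2 a b l) = ((phi a).1.1.1,
           affR (phi a).1.1.2 (phi b).1.1.2 l,
           (phi a).1.2, affR (phi a).2 (phi b).2 l))].
Proof.
have [_ _ _ [_ [_ [f1 [f2 [[[g1 [_ _ K1 _]] [g2 [_ _ K2 _]]]
  [_ _ H1 L1] [_ _ H2 L2] _ [_ _ G1 _]]]]]]] := C.
have P1 a : carrier E a -> U (q2 (p2 a)) -> (phi a).1.1 = f1 (p1 a).
  move=> Ea Ua; rewrite -(H1 a (conj Ea Ua)) /=.
  by case: (phi a) => [[[x y] z] c].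
have P2 a : carrier E a -> U (q2 (p2 a)) ->
    ((phi a).1.1.1, (phi a).1.2) = f2 (p2 a).
  move=> Ea Ua; rewrite -(H2 a (conj Ea Ua)) /=.
  by case: (phi a) => [[[x y] z] c].
exists f1, f2; split; [split=> //|split=> //| |].
- by move=> a Aa Ua; exact: (G1 a (conj Aa Ua)).
- move=> a b Aa Ab Ua Ub fab.
  by rewrite -(K1 a (conj Aa Ua)) fab; exact: (K1 b (conj Ab Ub)).
- move=> a b Aa Ab Ua Ub fab.
  by rewrite -(K2 a (conj Aa Ua)) fab; exact: (K2 b (conj Ab Ub)).
- move=> a b l Ea Eb Ua Ub ab.
  have e : (phi a).1.1 = (phi b).1.1 by rewrite !P1// ab.
  rewrite [LHS](L1 a b l (conj Ea Ua) (conj Eb Ub) ab) /= e.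
  by case: (phi a) (phi b) => [[[x y] z] c] [[[x' y'] z'] c'].
- move=> a b l Ea Eb Ua Ub ab.
  have : ((phi a).1.1.1, (phi a).1.2) = ((phi b).1.1.1, (phi b).1.2).
    by rewrite !P2// ab.
  case=> e e'.
  rewrite [LHS](L2 a b l (conj Ea Ua) (conj Eb Ub) ab) /= e e'.
  by case: (phi a) (phi b) => [[[x y] z] c] [[[x' y'] z'] c'].
Qed.

End OneChart.

(** The change of charts [T] preserves both affine structures of the trivial
    double affine bundle, so its components are affine or biaffine. Their
    coefficients are combinations of values of [T] at points with constant
    coordinates, which depend smoothly on [x]. *)
Lemma adapted_chart_transition (U U' : set M) (phi phi' : E -> coords)
    (psi psi' : coords -> E) :
  @adapted_chart R D n1 n2 n U phi psi -> @adapted_chart R D n1 n2 n U' phi' psi' ->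
  exists
    (alpha0 : 'I_n1 -> M -> R) (alpha : 'I_n1 -> 'I_n1 -> M -> R)
    (beta0 : 'I_n2 -> M -> R) (beta : 'I_n2 -> 'I_n2 -> M -> R)
    (gamma00 : 'I_n -> M -> R) (gamma10 : 'I_n1 -> 'I_n -> M -> R)
    (gamma01 : 'I_n2 -> 'I_n -> M -> R)
    (gamma11 : 'I_n1 -> 'I_n2 -> 'I_n -> M -> R)
    (sigma : 'I_n -> 'I_n -> M -> R),
    [/\ [/\ (forall j, smooth_coef (U `&` U') (alpha0 j)),
            (forall k j, smooth_coef (U `&` U') (alpha k j)),
            (forall a, smooth_coef (U `&` U') (beta0 a)) &
            (forall b a, smooth_coef (U `&` U') (beta b a))],
        [/\ (forall u, smooth_coef (U `&` U') (gamma00 u)),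
            (forall k u, smooth_coef (U `&` U') (gamma10 k u)),
            (forall b u, smooth_coef (U `&` U') (gamma01 b u)),
            (forall k b u, smooth_coef (U `&` U') (gamma11 k b u)) &
            (forall w u, smooth_coef (U `&` U') (sigma w u))] &
        forall (x : M) (y : 'rV[R]_n1) (z : 'rV[R]_n2) (c : 'rV[R]_n),
          U x -> U' x ->
          exists (y' : 'rV[R]_n1) (z' : 'rV[R]_n2) (c' : 'rV[R]_n),
            [/\ phi' (psi (x, y, z, c)) = (x, y', z', c'),
                (forall j, y' 0 j = alpha0 j x + \sum_k alpha k j x * y 0 k),
                (forall a, z' 0 a = beta0 a x + \sum_b beta b a x * z 0 b) &
                (forall u, c' 0 u = gamma00 u x
                   + \sum_k gamma10 k u x * y 0 k
                   + \sum_b gamma01 b u x * z 0 b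
                   + \sum_k \sum_b gamma11 k b u x * y 0 k * z 0 b
                   + \sum_w sigma w u x * c 0 w)]].
Proof.
move=> C C'.
have [f1 [f2 [[P1 B1 I1] [P2 I2] L1 L2]]] := adapted_chart_morph C.
have [f1' [f2' [[P1' B1' I1'] [P2' I2'] L1' L2']]] := adapted_chart_morph C'.
have psiK := adapted_chart_psiK C; have phiK := adapted_chart_phiK C.
pose T x y z c := phi' (psi (x, y, z, c)).
have Ap1 a : carrier E a -> carrier A1 (p1 a) by exact: (affine_bundle_proj
    (affine_pi1 dD)).
have Ap2 a : carrier E a -> carrier A2 (p2 a) by exact: (affine_bundle_proj
    (affine_pi2 dD)).
have base t : U t.1.1.1 -> q2 (p2 (psi t)) = t.1.1.1.
  move=> Ut; have [Ep Up Kp] := psiK t Ut.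
  by rewrite -{2}Kp P1// B1 ?(base_eq dD)//; exact: Ap1.
have same1 x y z c z' c' : U x -> p1 (psi (x, y, z, c)) = p1 (psi (x, y, z', c')).
  move=> Ux; have [Ep Up Kp] := psiK (x, y, z, c) Ux.
  have [Ep' Up' Kp'] := psiK (x, y, z', c') Ux.
  apply: I1; rewrite ?(base_eq dD)//; try exact: Ap1.
  by rewrite -!P1// Kp Kp'.
have same2 x y z c y' c' : U x -> p2 (psi (x, y, z, c)) = p2 (psi (x, y', z, c')).
  move=> Ux; have [Ep Up Kp] := psiK (x, y, z, c) Ux.
  have [Ep' Up' Kp'] := psiK (x, y', z, c') Ux.
  apply: I2 => //; try exact: Ap2.
  by rewrite -!P2// Kp Kp'.
have inU' x y z c : U x -> U' x ->
    carrier E (psi (x, y, z, c)) /\ U' (q2 (p2 (psi (x, y, z, c)))).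
  move=> Ux U'x; have [Ep _ _] := psiK (x, y, z, c) Ux.
  by split=> //; rewrite base.
have Tx x y z c : U x -> U' x -> (T x y z c).1.1.1 = x.
  move=> Ux U'x; have [Ep Up] := inU' x y z c Ux U'x.
  rewrite /T P1'// B1' ?(base_eq dD) ?base//; exact: Ap1.
have Ty x y z c z' c' : U x -> U' x -> (T x y z c).1.1.2 = (T x y z' c').1.1.2.
  move=> Ux U'x; have [Ep Up] := inU' x y z c Ux U'x.
  have [Ep' Up'] := inU' x y z' c' Ux U'x.
  by rewrite /T P1'// (same1 x y z c z' c' Ux) -P1'.
have Tz x y z c y' c' : U x -> U' x -> (T x y z c).1.2 = (T x y' z c').1.2.
  move=> Ux U'x; have [Ep Up] := inU' x y z c Ux U'x.
  have [Ep' Up'] := inU' x y' z c' Ux U'x.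
  have := P2' _ Ep Up; rewrite (same2 x y z c y' c' Ux) -P2'//.
  by case.
have T1 x y z z' c c' l : U x -> U' x -> T x y (affR z z' l) (affR c c' l) =
    (x, (T x y z c).1.1.2, affR (T x y z c).1.2 (T x y z' c').1.2 l,
     affR (T x y z c).2 (T x y z' c').2 l).
  move=> Ux U'x; have [Ep Up] := inU' x y z c Ux U'x.
  have [Ep' Up'] := inU' x y z' c' Ux U'x.
  have [_ UUp Kp] := psiK (x, y, z, c) Ux; have [_ UUp' Kp'] := psiK (x, y, z',
      c') Ux.
  have e := same1 x y z c z' c' Ux.
  have [E1 e1] := affine_bundle_closed (affine_pi1 dD) l Ep Ep' e.
  have K := L1 _ _ l Ep Ep' UUp UUp' e; rewrite Kp Kp' /= in K.
  rewrite {1}/T -K phiK//; last by rewrite -(base_eq dD)// e1 (base_eq dD).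
  by rewrite L1'// -/(T x y z c) Tx.
have T2 x y y' z c c' l : U x -> U' x -> T x (affR y y' l) z (affR c c' l) =
    (x, affR (T x y z c).1.1.2 (T x y' z c').1.1.2 l, (T x y z c).1.2,
     affR (T x y z c).2 (T x y' z c').2 l).
  move=> Ux U'x; have [Ep Up] := inU' x y z c Ux U'x.
  have [Ep' Up'] := inU' x y' z c' Ux U'x.
  have [_ UUp Kp] := psiK (x, y, z, c) Ux; have [_ UUp' Kp'] := psiK (x, y', z,
      c') Ux.
  have e := same2 x y z c y' c' Ux.
  have [E1 e1] := affine_bundle_closed (affine_pi2 dD) l Ep Ep' e.
  have K := L2 _ _ l Ep Ep' UUp UUp' e; rewrite Kp Kp' /= in K.
  rewrite {1}/T -K phiK//; last by rewrite e1.
  by rewrite L2'// -/(T x y z c) Tx.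
pose X4 := product (product (product M (Eu n1)) (Eu n2)) (Eu n).
have CT y z c : smooth_in M X4 (U `&` U') (fun x => T x y z c).
  have [_ UM [_ [Cpsi _] _ _] _] := C; have [_ _ [[Cphi' _] _ _ _] _] := C'.
  apply: (@smooth_on_comp R M E X4 _ _ _ _ (carrier E `&` (q2 \o p2) @^-1` U')
    (fun x => psi (x, y, z, c)) phi') => //.
    by move=> x [Ux U'x]; exact: inU'.
  apply: (@smooth_on_comp R M X4 E _ _ _ _
    (carrier (tot (trivial_dbundle (restr (E := M) U) n1 n2 n)))
    (fun x => (x, y, z, c)) psi) => //.
    by move=> x [Ux U'x]; exact: (conj (conj (conj (conj (UM _ Ux) Ux) I) I) I).
  apply: smooth_on_pair; last exact: (@smooth_on_cst R M (Eu n)).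
  apply: smooth_on_pair; last exact: (@smooth_on_cst R M (Eu n2)).
  by apply: smooth_on_pair; [exact: smooth_on_id|exact: (@smooth_on_cst R M
      (Eu n1))].
have CY y z c j : smooth_in M RL (U `&` U') (fun x => (T x y z c).1.1.2 0 j).
  exact: (smooth_on_coord j (smooth_on_snd (smooth_on_fst (smooth_on_fst
      (CT y z c))))).
have CZ y z c j : smooth_in M RL (U `&` U') (fun x => (T x y z c).1.2 0 j).
  exact: (smooth_on_coord j (smooth_on_snd (smooth_on_fst (CT y z c)))).
have CF y z c j : smooth_in M RL (U `&` U') (fun x => (T x y z c).2 0 j).
  exact: (smooth_on_coord j (smooth_on_snd (CT y z c))).
have Csub f g : smooth_in M RL (U `&` U') f -> smooth_in M RL (U `&` U') g ->
    smooth_in M RL (U `&` U') (fun x => f x - g x).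
  by move=> Cf Cg; apply: smooth_on_add => //; exact: smooth_on_opp.
have a0 k l : affR 0 0 l = 0 :> 'rV[R]_k by rewrite /affR !scaler0 addr0.
pose F x y z c := (T x y z c).2.
exists (fun j x => (T x 0 0 0).1.1.2 0 j),
  (fun k j x => (T x 'e_k 0 0).1.1.2 0 j - (T x 0 0 0).1.1.2 0 j),
  (fun a x => (T x 0 0 0).1.2 0 a),
  (fun b a x => (T x 0 'e_b 0).1.2 0 a - (T x 0 0 0).1.2 0 a),
  (fun u x => F x 0 0 0 0 u),
  (fun k u x => F x 'e_k 0 0 0 u - F x 0 0 0 0 u),
  (fun b u x => F x 0 'e_b 0 0 u - F x 0 0 0 0 u),
  (fun k b u x => F x 'e_k 'e_b 0 0 u - F x 'e_k 0 0 0 u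
        - (F x 0 'e_b 0 0 u - F x 0 0 0 0 u)),
  (fun w u x => F x 0 0 'e_w 0 u - F x 0 0 0 0 u).
split.
- split=> *; [exact: CY|by apply: Csub; exact: CY|exact: CZ|by apply: Csub;
    exact: CZ].
- split=> *; [exact: CF| | | |]; try by apply: Csub; exact: CF.
  by apply: (Csub); apply: (Csub); exact: CF.
move=> x y z c Ux U'x.
exists (T x y z c).1.1.2, (T x y z c).1.2, (T x y z c).2; split.
- have := Tx x y z c Ux U'x; rewrite /T.
  by case: (phi' _) => [[[x' y'] z'] c'] /= ->.
- move=> j; rewrite (Ty x y z c 0 0 Ux U'x).
  apply: (affR_coord (F := fun y => (T x y 0 0).1.1.2)) => v v' l.
  by by have := T2 x v v' 0 0 0 l Ux U'x; rewrite a0 => ->.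
- move=> a; rewrite (Tz x y z c 0 0 Ux U'x).
  apply: (affR_coord (F := fun z => (T x 0 z 0).1.2)) => v v' l.
  by by have := T1 x 0 v v' 0 0 l Ux U'x; rewrite a0 => ->.
- apply: (biaffine_coord (F := F x)) => *.
    by rewrite /F T1.
  by rewrite /F T2.
Qed.

End Transition.

Theorem theorem2p1 (R : realType) (D : dbundle R) :
  double_affine_bundle D ->
  connected (carrier (base D)) ->
  exists (I : Type) (U : I -> set (base D)) (n1 n2 n : nat)
    (phi : forall i, tot D -> tot (trivial_dbundle (restr (U i)) n1 n2 n))
    (psi : forall i, tot (trivial_dbundle (restr (U i)) n1 n2 n) -> tot D),
    [/\ (forall i, open (U i)),
        \bigcup_i U i = carrier (base D),
        (forall i, diffeo_with_inverse
           (E := tot (restr_dbundle (U i)))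
           (F := tot (trivial_dbundle (restr (U i)) n1 n2 n)) (phi i) (psi i)),
        (forall i, dbundle_iso
           (D := restr_dbundle (U i))
           (D' := trivial_dbundle (restr (U i)) n1 n2 n) (phi i) id) &
        forall i i', exists
          (alpha0 : 'I_n1 -> base D -> R)
          (alpha : 'I_n1 -> 'I_n1 -> base D -> R)
          (beta0 : 'I_n2 -> base D -> R)
          (beta : 'I_n2 -> 'I_n2 -> base D -> R)
          (gamma00 : 'I_n -> base D -> R)
          (gamma10 : 'I_n1 -> 'I_n -> base D -> R)
          (gamma01 : 'I_n2 -> 'I_n -> base D -> R)
          (gamma11 : 'I_n1 -> 'I_n2 -> 'I_n -> base D -> R)
          (sigma : 'I_n -> 'I_n -> base D -> R),
          [/\ [/\ (forall j, smooth_coef (U i `&` U i') (alpha0 j)),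
                  (forall k j, smooth_coef (U i `&` U i') (alpha k j)),
                  (forall a, smooth_coef (U i `&` U i') (beta0 a)) &
                  (forall b a, smooth_coef (U i `&` U i') (beta b a))],
              [/\ (forall u, smooth_coef (U i `&` U i') (gamma00 u)),
                  (forall k u, smooth_coef (U i `&` U i') (gamma10 k u)),
                  (forall b u, smooth_coef (U i `&` U i') (gamma01 b u)),
                  (forall k b u, smooth_coef (U i `&` U i') (gamma11 k b u)) &
                  (forall w u, smooth_coef (U i `&` U i') (sigma w u))] &
              forall (x : base D) (y : 'rV[R]_n1) (z : 'rV[R]_n2) (c : 'rV[R]_n),
                U i x -> U i' x ->
                exists (y' : 'rV[R]_n1) (z' : 'rV[R]_n2) (c' : 'rV[R]_n),
                  [/\ phi i' (psi i (x, y, z, c)) = (x, y', z', c'),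
                      (forall j, y' 0 j = alpha0 j x
                         + \sum_k alpha k j x * y 0 k),
                      (forall a, z' 0 a = beta0 a x
                         + \sum_b beta b a x * z 0 b) &
                      (forall u, c' 0 u = gamma00 u x
                         + \sum_k gamma10 k u x * y 0 k
                         + \sum_b gamma01 b u x * z 0 b
                         + \sum_k \sum_b gamma11 k b u x * y 0 k * z 0 b
                         + \sum_w sigma w u x * c 0 w)]]].
Proof.
move: D => [E A1 A2 M p1 p2 q2 q1] dD _ /=.
have [n1 [n2 [n H]]] := adapted_chart_exists dD.
pose I := {x : M | carrier M x}.
have /choice[U /choice[phi /choice[psi C]]] : forall i : I, exists U phi psi,
    U (sval i) /\ @adapted_chart R (DBundle p1 p2 q2 q1) n1 n2 n U phi psi.
  by move=> [x Mx]; exact: H.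
exists I, U, n1, n2, n, phi, psi; split.
- by move=> i; have [_ []] := C i.
- apply/seteqP; split=> [x [i _ Ux]|x Mx].
    by have [_ [_ UM _ _]] := C i; exact: UM.
  by exists (exist _ x Mx) => //; have [] := C (exist _ x Mx).
- by move=> i; have [_ []] := C i.
- by move=> i; have [_ []] := C i.
- by move=> i i'; apply: (adapted_chart_transition dD (proj2 (C i)) (proj2 (C i'))).
Qed.
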